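(* Let $1\le\kappa<\infty$ and let $(a(e);e\in\mathbb L^d)$ be i.i.d. random conductances on the edges of $\mathbb Z^d$ such that $0<a(e)\le\kappa$ for all edges $e$. Let $C_0=32d\kappa^3$ and let $f_N$ be the effective conductance between opposite faces of $Q_N=\{1,\dots,N\}^d$ (defined in the context). (i) If $d\ge 5$, then for all $N\ge1$, $\mathrm{Var}(f_N)\le 128 d\kappa^2N^{4-d}$, and for all $t>0$ and $N\ge 1$, $$\mathbb P\big(|f_N-\mathbb E f_N|\ge tN^{(4-d)/2}\big)\le 4\exp\big(-t/(8\kappa\sqrt{2d})\big).$$ (ii) Suppose moreover that for some constants $D_0<\infty$ and $\gamma$ with $0<\gamma<2$, $$\mathbb P(a^{-1}(e)\ge s)\le D_0\,s^{1-2/\gamma}\quad\text{for all } s\ge 1.$$ If $d\ge 4$, or if $d=3$ and $1/2\le\gamma<1$, then for all $N\ge 1$ $$\mathrm{Var}(f_N)\le 16C_0(D_0+1)N^{2-d+\gamma},$$ and for all $0<t<\left(\frac{C_0(D_0+1)^5}{8}\right)^{1/2}N^{(d-6+5\gamma)/2}$, $$\mathbb P(|f_N-\mathbb E f_N|>t)\le 11c_1\exp\left(-\frac{c_2}{2\sqrt{2C_0(D_0+1)}}\,N^{(d-2-\gamma)/2}\,t\right),$$ where $c_1,c_2$ are the universal constants of the martingale inequality recalled in the context; in particular they do not depend on $\kappa$, $d$ or $N$. (iii) If the tail condition in (ii) holds, $d=3$ and $0<\gamma\le 1/2$, then for all $N\ge1$, $\mathrm{Var}(f_N)\le 16C_0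(D_0+1)N^{-1/2}$.
   Context: $\mathbb L^d$ is the set of nearest-neighbour edges of $\mathbb Z^d$; $x\sim y$ means $|x-y|=1$ (Euclidean norm); $a(x,y)=a(y,x)$ is the conductance of the edge with endpoints $x\sim y$. $\mathbb P$ is the law of the conductances, with expectation $\mathbb E$ and variance $\mathrm{Var}$. $Q_N=\{1,\dots,N\}^d$, $\overline Q_N=\{0,\dots,N+1\}^d$, $\partial Q_N=\overline Q_N\setminus Q_N$; $x(1)$ is the first coordinate of $x$. $\mathcal V_N$ is the set of functions $u:\overline Q_N\to\mathbb R$ with $u=0$ on $\{x(1)=0\}\cap\partial Q_N$, $u=N+1$ on $\{x(1)=N+1\}\cap\partial Q_N$, and $u(x)=u(y)$ whenever $x\sim y$, $x\in\partial Q_N$ with $x(1)\notin\{0,N+1\}$, and $y\in Q_N$. $\mathcal E_N(u,v)=\sum a(x,y)(u(x)-u(y))(v(x)-v(y))$, the sum being over edges $\{x,y\}$ with $x\in Q_N$, $y\in\overline Q_N$, $x\sim y$, each edge counted once. $f_N=N^{-d}\mathcal E_N(v_N,v_N)=N^{-d}\inf\{\mathcal E_N(u,u):u\in\mathcal V_N\}$, where $v_N\in\mathcal V_N$ is the minimizer, i.e. the element of $\mathcal V_N$ with $\sum_{y\sim x}a(x,y)(v_N(x)-v_N(y))=0$ for all $x\in Q_N$ (unique up to its irrelevant values at vertices of $\partial Q_N$ having no neighbour in $Q_N$). Martingale inequality (Kesten) fixing the universal constants $c_1,c_2\in(0,\infty)$: let $(M_n;n\ge0)$ be a martingale with respect to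 a filtration $(\mathcal F_n)$ and $\Delta_k=M_k-M_{k-1}$. Suppose $|\Delta_k|\le B_1<\infty$ for all $k\ge1$; that for some random variables $U_k\ge0$ (not necessarily $\mathcal F_k$-measurable) $\mathbb E(\Delta_k^2|\mathcal F_{k-1})\le\mathbb E(U_k|\mathcal F_{k-1})$ for all $k\ge 1$; and that for constants $0<C_1,C_2<\infty$ and $s_0\ge e^2B_1^2$, $\mathbb P(\sum_kU_k>s)\le C_1\exp(-C_2s^2)$ for all $s\ge s_0$. Then for all $s>0$, $\mathbb P(|M_\infty-M_0|>s)\le c_1\left(1+C_1+\frac{C_1}{s_0^2C_2}\right)\exp\left(-c_2\frac{s}{s_0^{1/2}+(s/(s_0C_2))^{1/3}}\right)$, where $M_\infty$ is the limit of $M_n$ and $c_1,c_2$ do not depend on $B_1,s_0,C_1,C_2$ nor on the distribution of $(M_k)$ and $(U_k)$. *)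

(* Defs.v *)
From HB Require Import structures.
From mathcomp Require Import all_boot all_order all_algebra.
From mathcomp Require Import all_classical all_reals all_analysis.
From mathcomp Require Import zify.

Set Implicit Arguments.
Unset Strict Implicit.
Unset Printing Implicit Defensive.

Import Order.TTheory GRing.Theory Num.Theory.
Import numFieldNormedType.Exports.

Local Open Scope classical_set_scope.
Local Open Scope ring_scope.

(* Edges of the lattice Z^d.  The unoriented edge {x, x + e_i} is encoded by
   the pair (x, i); [adjP] shows that each pair of neighbours is the pair of
   endpoints of an edge, and [edge_endpoints_inj] that this edge is unique. *)
Definition site (d : nat) := 'rV[int]_d.

Definition edge (d : nat) := (site d * 'I_d)%type.

Definition src d (e : edge d) : site d := e.1.

Definition tgt d (e : edge d) : site d := e.1 + delta_mx 0 e.2.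

(* |x - y| = 1 for the Euclidean norm; over the integers this is the same as
   its square being 1. *)
Definition adj d (x y : site d) : Prop :=
  \sum_(i < d) (x 0 i - y 0 i) ^+ 2 = 1.

(* The coordinate x(1); the value 0 is only used when d = 0. *)
Definition coord1 d (x : site d) : int :=
  oapp (fun i : 'I_d => x 0 i) 0 (insub 0%N).

Definition box (d N : nat) : set (site d) :=
  [set x | forall i, 1 <= x 0 i <= N%:Z].
Arguments box d N _ : clear implicits.

Definition cbox (d N : nat) : set (site d) :=
  [set x | forall i, 0 <= x 0 i <= N%:Z + 1].
Arguments cbox d N _ : clear implicits.

Definition bdbox (d N : nat) : set (site d) := cbox d N `\` box d N.
Arguments bdbox d N _ : clear implicits.

Definition box_edges (d N : nat) : set (edge d) :=
  [set e | (box d N (src e) /\ cbox d N (tgt e)) \/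
           (cbox d N (src e) /\ box d N (tgt e))].
Arguments box_edges d N _ : clear implicits.

(* Functions are defined on all of Z^d, but only their values on [cbox d N]
   occur in [potentials] and in [energy]. *)
Definition potentials (R : realType) (d N : nat) : set (site d -> R) :=
  [set u | [/\ forall x, bdbox d N x -> coord1 x = 0 -> u x = 0,
               forall x, bdbox d N x -> coord1 x = N%:Z + 1 -> u x = N%:R + 1 &
               forall x y, adj x y -> bdbox d N x ->
                 coord1 x <> 0 -> coord1 x <> N%:Z + 1 -> box d N y ->
                 u x = u y]].
Arguments potentials R d N _ : clear implicits.

Definition energy (R : realType) (d N : nat) (c : edge d -> R)
    (u v : site d -> R) : R :=
  \sum_(e \in box_edges d N)
    c e * (u (src e) - u (tgt e)) * (v (src e) - v (tgt e)).

Definition eff_cond (R : realType) (d N : nat) (c : edge d -> R) : R :=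
  (N%:R ^+ d)^-1 * inf [set energy N c u u | u in potentials R d N].

Section probability.
Context {disp : measure_display} {T : measurableType disp} {R : realType}.
Variable P : probability T R.

Definition mutually_independent (I : eqType) (X : I -> {RV P >-> R}) : Prop :=
  forall (s : seq I) (B : I -> set R), uniq s ->
    (forall i, measurable (B i)) ->
    P (\big[setI/setT]_(i <- s) (X i @^-1` B i)) =
    (\prod_(i <- s) P (X i @^-1` B i))%E.

Definition identically_distributed (I : Type) (X : I -> {RV P >-> R}) : Prop :=
  forall (i j : I) (B : set R), measurable B ->
    distribution P (X i) B = distribution P (X j) B.

(* Y is a version of E(X | G). *)
Definition is_cond_exp (G : set (set T)) (X Y : T -> R) : Prop :=
  [/\ P.-integrable setT (EFin \o X), P.-integrable setT (EFin \o Y),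
      forall B : set R, measurable B -> G (Y @^-1` B) &
      forall A, G A -> (\int[P]_(w in A) (Y w)%:E = \int[P]_(w in A) (X w)%:E)%E].

(* E(X | G) <= E(Y | G) almost surely. *)
Definition cond_exp_le (G : set (set T)) (X Y : T -> R) : Prop :=
  exists X' Y' : T -> R, [/\ is_cond_exp G X X', is_cond_exp G Y Y' &
    {ae P, forall w, X' w <= Y' w}].

Definition filtration (F : nat -> set (set T)) : Prop :=
  [/\ forall n, sigma_algebra setT (F n), forall n, F n `<=` measurable &
      forall n, F n `<=` F n.+1].

(* [is_cond_exp] includes that M n is F n-measurable and integrable. *)
Definition martingale (F : nat -> set (set T)) (M : nat -> T -> R) : Prop :=
  forall n, is_cond_exp (F n) (M n.+1) (M n).

End probability.

(* c1 and c2 are admissible constants in Kesten's martingale inequality, which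
   is quantified over all probability spaces.  The condition 0 < s0 is implicit
   in the bound, where s0 occurs in denominators. *)
Definition kesten_constants (R : realType) (c1 c2 : R) : Prop :=
  [/\ 0 < c1, 0 < c2 &
  forall (disp : measure_display) (T : measurableType disp)
    (P : probability T R) (F : nat -> set (set T)) (M : nat -> T -> R)
    (Minf : {RV P >-> R}) (U : nat -> {RV P >-> R}) (B1 C1 C2 s0 : R),
  filtration F -> martingale P F M ->
  {ae P, forall w, (fun n => M n w) @ \oo --> Minf w} ->
  (forall k, {ae P, forall w, `|M k.+1 w - M k w| <= B1}) ->
  (forall k w, 0 <= U k w) ->
  (forall k, cond_exp_le P (F k) (fun w => (M k.+1 w - M k w) ^+ 2) (U k.+1)) ->
  0 < C1 -> 0 < C2 -> 0 < s0 -> expR 2 * B1 ^+ 2 <= s0 ->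
  (forall s : R, s0 <= s ->
    (P [set w | s%:E < \sum_(1 <= k <oo) (U k w)%:E] <=
     (C1 * expR (- (C2 * s ^+ 2)))%:E)%E) ->
  forall s : R, 0 < s ->
    (P [set w | (s < `|Minf w - M 0%N w|)%R] <=
    (c1 * (1 + C1 + C1 / (s0 ^+ 2 * C2)) *
     expR (- (c2 * (s / (Num.sqrt s0 + (s / (s0 * C2)) `^ (3^-1))))))%:E)%E].

Lemma tgtE d (e : edge d) i : tgt e 0 i = src e 0 i + (i == e.2)%:Z.
Proof. by rewrite /tgt /src !mxE natz. Qed.

Lemma adj_edge d (e : edge d) : adj (src e) (tgt e).
Proof.
rewrite /adj (bigD1 e.2) //= big1 => [|i ie]; last first.
  by rewrite tgtE (negbTE ie) addr0 subrr expr0n.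
by rewrite tgtE eqxx opprD addrA subrr sub0r sqrrN expr1n addr0.
Qed.

Lemma adj_sym d (x y : site d) : adj x y -> adj y x.
Proof.
by rewrite /adj => <-; apply: eq_bigr => i _; rewrite -sqrrN opprB.
Qed.

Lemma adjP d (x y : site d) : adj x y <->
  exists e : edge d, (x = src e /\ y = tgt e) \/ (x = tgt e /\ y = src e).
Proof.
split; last first.
  by move=> [e [[-> ->]|[-> ->]]]; [|apply: adj_sym]; exact: adj_edge.
rewrite /adj => h.
have [i hi] : exists i, x 0 i - y 0 i != 0.
  apply/existsP; apply: contraPT h => /existsPn h.
  by rewrite big1 // => i _; move: (h i); rewrite negbK => /eqP ->; rewrite expr0n.
rewrite (bigD1 i) //= in h.
have h0 : 0 <= \sum_(j < d | j != i) (x 0 j - y 0 j) ^+ 2.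
  by apply: sumr_ge0 => j _; exact: sqr_ge0.
have [hs ht] : \sum_(j < d | j != i) (x 0 j - y 0 j) ^+ 2 = 0 /\
    (x 0 i - y 0 i = 1 \/ x 0 i - y 0 i = -1).
  move: hi h0 h; set S := \sum_(j < d | _) _; move: S (_ - _) => S t.
  by rewrite expr2 => /eqP; nia.
have hj j : j != i -> x 0 j = y 0 j.
  move=> ji; have /eqP := psumr_eq0P (fun j _ => sqr_ge0 (x 0 j - y 0 j)) hs ji.
  by rewrite sqrf_eq0 subr_eq0 => /eqP.
have [e1|e1] : y 0 i = x 0 i + 1 \/ x 0 i = y 0 i + 1 by lia.
  exists (x, i); left; split=> //; apply/rowP => j; rewrite tgtE /=.
  by have [->//|/hj ->] := eqVneq j i; rewrite addr0.
exists (y, i); right; split=> //; apply/rowP => j; rewrite tgtE /=.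
by have [->//|/hj ->] := eqVneq j i; rewrite addr0.
Qed.

Lemma edge_endpoints_inj d (e f : edge d) :
  (src e = src f /\ tgt e = tgt f) \/ (src e = tgt f /\ tgt e = src f) -> e = f.
Proof.
case: e f => [x i] [y j]; have H k := tgtE (x, i) k; have K k := tgtE (y, j) k.
rewrite /= in H K.
move=> [[e1 e2]|[e1 e2]].
  have := H i; rewrite e2 K eqxx; rewrite /src /= in e1 *; rewrite e1.
  by case: eqVneq => [->//|_] /addrI.
have := H i; rewrite e2; have := K i; rewrite -e1 /src /= eqxx.
by case: (i == j) => /=; lia.
Qed.

Lemma finite_box_edges d N : finite_set (box_edges d N).
Proof.
pose f (p : {ffun 'I_d -> 'I_N.+2} * 'I_d) : edge d :=
  (\row_i ((p.1 i : nat)%:Z), p.2).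
apply: (sub_finite_set (B := range f)); last first.
  by apply: finite_image; exact: finite_finset.
move=> [x i] h.
have hx : cbox d N x.
  by case: h => -[h _] // k; have := h k; rewrite /src /=; lia.
exists ([ffun k => inord (absz (x 0 k))], i) => //.
congr pair; apply/rowP => k; rewrite mxE ffunE inordK; have := hx k; lia.
Qed.

(* Main.v *)
Require Import Defs.
From HB Require Import structures.
From mathcomp Require Import all_boot all_order all_algebra.
From mathcomp Require Import all_classical all_reals all_analysis.
From mathcomp Require Import measurable_realfun lra ring zify.
Import Order.TTheory GRing.Theory Num.Theory.
Import numFieldNormedType.Exports.
Local Open Scope classical_set_scope.
Local Open Scope ring_scope.

(** The potential that minimizes the energy for conductances [c] is a test
    function for the energy of every other choice of conductances.  Raising the
    conductance of one edge [e] to its maximal value [kappa] therefore raises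
    the minimal energy, by at most [kappa] times the squared gradient of the
    minimizer across [e] ([min_energy_update_le]).  By truncation all gradients
    are at most [N + 1], so one edge changes the conductance by at most
    [4 kappa N^(2-d)], and there are at most [2 d N^d] edges.

    The probabilistic input is a concentration theory for functions of
    independent coordinates.  A version of the conditional expectation given
    some of the coordinates is obtained explicitly, by integrating out the others one
    at a time ([avgs]).  The variance of such a function is at most the sum over
    the coordinates of the mean squared change caused by moving this coordinate
    to a fixed value ([efron_stein]); the fixed value is [kappa] here, which
    makes the changes one-sided and lets them be read off from one minimizer.
    Part (i) follows from this and from the bounded difference inequality
    ([bounded_differences]).

    For parts (ii) and (iii) the uniform bound on gradients is combined with the
    energy identity.  An edge with [c e > 1/s] has squared gradient at most
    [s] times its share of the energy, and the energy of the minimizer is of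
    order [N^d]; for the remaining weak edges the uniform bound is used
    ([sum_gradient4_le]).  The sum of the fourth powers of the gradients is thus
    of order [s N^(d+2)] plus [N^4] times the number of weak edges.  The tail
    assumption makes the mean number of weak edges of order [N^d s^(1-2/gamma)],
    and [s = N^gamma] balances the two terms ([weak_mean_contribution]).  This
    gives the variance.  For the deviation estimate, Kesten's inequality is
    applied to the martingale that reveals the conductances one by one, with the
    squared changes as [U_k] ([kesten_bounded_differences]); their sum has a
    Gaussian tail because the number of weak edges changes by at most one when
    one conductance changes ([sum_sqr_increment_tail]).  Part (iii) is the
    variance bound of (ii) for the exponent 1/2, the tail condition being weaker
    for larger [gamma]. *)

Set Implicit Arguments.
Unset Strict Implicit.
Unset Printing Implicit Defensive.

(** * Means of bounded functions *)

Section bounded_measurable.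
Context {d : measure_display} {T : measurableType d} {R : realType}.
Implicit Types f g : T -> R.

(** Boundedness makes every mean below finite, so that means are additive and
    monotone without further integrability conditions. *)
Definition bmeas f :=
  measurable_fun setT f /\ exists M, forall x, `|f x| <= M.

Lemma bmeas_cst c : bmeas (fun=> c).
Proof. by split; [exact: measurable_cst | exists `|c|]. Qed.

Lemma bmeasD f g : bmeas f -> bmeas g -> bmeas (fun x => f x + g x).
Proof.
move=> [mf [M hM]] [mg [K hK]]; split; first exact: measurable_funD.
by exists (M + K) => x; rewrite (le_trans (ler_normD _ _))// lerD.
Qed.

Lemma bmeasM f g : bmeas f -> bmeas g -> bmeas (fun x => f x * g x).
Proof.
move=> [mf [M hM]] [mg [K hK]]; split; first exact: measurable_funM.
by exists (M * K) => x; rewrite normrM ler_pM.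
Qed.

Lemma bmeasZ c f : bmeas f -> bmeas (fun x => c * f x).
Proof. by move=> bf; exact: (bmeasM (bmeas_cst c)). Qed.

Lemma bmeasB f g : bmeas f -> bmeas g -> bmeas (fun x => f x - g x).
Proof.
move=> [mf [M hM]] [mg [K hK]]; split; first exact: measurable_funB.
by exists (M + K) => x; rewrite (le_trans (ler_normB _ _))// lerD.
Qed.

Lemma bmeas_sqr f : bmeas f -> bmeas (fun x => f x ^+ 2).
Proof. by move=> bf; exact: (bmeasM bf bf). Qed.

Lemma bmeas_expR f : bmeas f -> bmeas (fun x => expR (f x)).
Proof.
move=> [mf [M hM]]; split; first exact: measurableT_comp.
exists (expR M) => x; rewrite ger0_norm ?expR_ge0// ler_expR.
exact: le_trans (ler_norm _) (hM x).
Qed.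

Lemma bmeas_sum (J : Type) (s : seq J) (f : J -> T -> R) :
  (forall j, bmeas (f j)) -> bmeas (fun x => \sum_(j <- s) f j x).
Proof.
move=> bf; elim: s => [|j s ih].
  by under [X in bmeas X]funext do rewrite big_nil; exact: bmeas_cst.
by under [X in bmeas X]funext do rewrite big_cons; exact: bmeasD.
Qed.

Lemma bmeas_indic (A : set T) : measurable A -> bmeas (\1_A : T -> R).
Proof.
move=> mA; split; first exact: measurable_indic.
by exists 1 => x; rewrite indicE; case: (_ \in _); rewrite ?normr1 ?normr0.
Qed.

Variable P : probability T R.

Lemma bmeas_integrable f : bmeas f -> P.-integrable setT (EFin \o f).
Proof.
move=> [mf [M hM]]; apply: (le_integrable _ _ _ (g := EFin \o cst M)) => //.
- exact/measurable_EFinP.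
- move=> x _ /=; rewrite lee_fin (le_trans (hM x))//; exact: ler_norm.
- exact: finite_measure_integrable_cst.
Qed.

Lemma EFin_Rintegral f : bmeas f ->
  (\int[P]_x f x)%:E = (\int[P]_x (f x)%:E)%E.
Proof.
by move=> bf; rewrite fineK//; apply: integrable_fin_num => //; exact: bmeas_integrable.
Qed.

Lemma meanD f g : bmeas f -> bmeas g ->
  \int[P]_x (f x + g x) = \int[P]_x f x + \int[P]_x g x.
Proof. by move=> bf bg; rewrite RintegralD//; exact: bmeas_integrable. Qed.

Lemma meanB f g : bmeas f -> bmeas g ->
  \int[P]_x (f x - g x) = \int[P]_x f x - \int[P]_x g x.
Proof. by move=> bf bg; rewrite RintegralB//; exact: bmeas_integrable. Qed.

Lemma meanZ c f : bmeas f -> \int[P]_x (c * f x) = c * \int[P]_x f x.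
Proof. by move=> bf; rewrite RintegralZl//; exact: bmeas_integrable. Qed.

Lemma mean_cst c : \int[P]_x c = c.
Proof.
have h : P setT = 1%E := probability_setT P.
by rewrite Rintegral_cst// [X in fine X]h mulr1.
Qed.

Lemma mean_le f g : bmeas f -> bmeas g -> (forall x, f x <= g x) ->
  \int[P]_x f x <= \int[P]_x g x.
Proof.
by move=> bf bg fg; apply: le_Rintegral => //; exact: bmeas_integrable.
Qed.

Lemma mean_sum (J : Type) (s : seq J) (f : J -> T -> R) :
  (forall j, bmeas (f j)) ->
  \int[P]_x (\sum_(j <- s) f j x) = \sum_(j <- s) \int[P]_x f j x.
Proof.
move=> bf; elim: s => [|j s ih].
  by under eq_Rintegral do rewrite big_nil; rewrite mean_cst big_nil.
under eq_Rintegral do rewrite big_cons.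
by rewrite meanD// ?ih ?big_cons//; exact: bmeas_sum.
Qed.

Lemma mean_indic (A : set T) : measurable A ->
  \int[P]_x (\1_A x : R) = fine (P A).
Proof. by move=> mA; rewrite /Rintegral integral_indic// setIT. Qed.

(** Expand the square around the mean; the cross term is centred. *)
Lemma mean_sqr_sub f c : bmeas f -> let m := \int[P]_x f x in
  \int[P]_x (f x - c) ^+ 2 = (m - c) ^+ 2 + \int[P]_x (f x - m) ^+ 2.
Proof.
move=> bf m.
have bs k : bmeas (fun x => (f x - k) ^+ 2).
  exact/bmeas_sqr/bmeasB/bmeas_cst.
have -> : \int[P]_x (f x - c) ^+ 2 =
    \int[P]_x ((f x - m) ^+ 2 + (2 * (m - c) * (f x - m) + (m - c) ^+ 2)).
  by apply: eq_Rintegral => x _; ring.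
have b1 : bmeas (fun x => 2 * (m - c) * (f x - m)).
  exact/bmeasZ/bmeasB/bmeas_cst.
rewrite meanD//; last by apply: bmeasD => //; exact: bmeas_cst.
rewrite meanD//; last exact: bmeas_cst.
rewrite meanZ; last exact/bmeasB/bmeas_cst.
rewrite meanB//; last exact: bmeas_cst.
rewrite !mean_cst -/m; ring.
Qed.

Lemma mean_sqr_sub_le f c : bmeas f ->
  \int[P]_x (f x - \int[P]_x f x) ^+ 2 <= \int[P]_x (f x - c) ^+ 2.
Proof. by move=> bf; rewrite (mean_sqr_sub c bf) lerDr sqr_ge0. Qed.

Lemma sqr_mean_le f : bmeas f -> (\int[P]_x f x) ^+ 2 <= \int[P]_x f x ^+ 2.
Proof.
move=> bf; have /= := mean_sqr_sub 0 bf; rewrite subr0 => h.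
have -> : \int[P]_x f x ^+ 2 = \int[P]_x (f x - 0) ^+ 2.
  by apply: eq_Rintegral => x _; rewrite subr0.
by rewrite h lerDl Rintegral_ge0// => x _; exact: sqr_ge0.
Qed.

Lemma mean_dist_le f (B : R) : bmeas f -> (forall x y, `|f x - f y| <= B) ->
  forall x, `|f x - \int[P]_y f y| <= B.
Proof.
move=> bf hB x.
have lo : \int[P]_y (f x - B) <= \int[P]_y f y.
  apply: mean_le => // [|y]; first exact: bmeas_cst.
  by have /ler_normlP[] := hB x y; lra.
have hi : \int[P]_y f y <= \int[P]_y (f x + B).
  apply: mean_le => // [|y]; first exact: bmeas_cst.
  by have /ler_normlP[] := hB x y; lra.
by rewrite !mean_cst in lo hi; apply/ler_normlP; split; lra.
Qed.

End bounded_measurable.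

Section exponential.
Context {R : realType}.

(** Square [expR (x / 2) <= 1 / (1 - x / 2)].  The factor 2 is what this crude
    bound needs at [x = 1]; the constants of the theorem leave room for it. *)
Lemma expR_le_quadratic (x : R) : `|x| <= 1 -> expR x <= 1 + x + 2 * x ^+ 2.
Proof.
rewrite ler_norml => /andP[x1 x2].
have h0 : 0 < 1 - x / 2 by lra.
have h1 : expR (x / 2) <= (1 - x / 2)^-1.
  rewrite -[leLHS]invrK -expRN lef_pV2 ?posrE ?expR_gt0//.
  by have := expR_ge1Dx (- (x / 2)); lra.
have -> : expR x = expR (x / 2) ^+ 2.
  by rewrite expr2 -expRD; congr expR; field.
apply: (@le_trans _ _ ((1 - x / 2)^-1 ^+ 2)).
  by rewrite lerXn2r// ?nnegrE ?expR_ge0// invr_ge0 ltW.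
rewrite exprVn -[leLHS]mul1r ler_pdivrMr ?exprn_gt0//.
have : 0 <= x ^+ 2 * ((1 - x) * (5 - 2 * x)).
  by rewrite mulr_ge0 ?sqr_ge0// mulr_ge0; lra.
nra.
Qed.

(** For [l * B <= 1] the linear term of the quadratic bound is centred; for
    [l * B > 1] the exponent [l * B] is already below its square, so the
    estimate holds for every [l]. *)
Lemma mean_expR_le {d} {T : measurableType d} (P : probability T R)
    (f : T -> R) (l B : R) :
  bmeas f -> 0 <= l -> (forall x, `|f x - \int[P]_y f y| <= B) ->
  \int[P]_x expR (l * f x) <=
    expR (2 * l ^+ 2 * B ^+ 2) * expR (l * \int[P]_x f x).
Proof.
move=> bf l0 hB; set m := \int[P]_x f x.
have bfm : bmeas (fun x => f x - m) by exact/bmeasB/bmeas_cst.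
have -> : \int[P]_x expR (l * f x) =
    expR (l * m) * \int[P]_x expR (l * (f x - m)).
  rewrite -meanZ; last exact/bmeas_expR/bmeasZ.
  by apply: eq_Rintegral => x _; rewrite -expRD; congr expR; ring.
rewrite mulrC ler_pM2r ?expR_gt0//.
have B0 : 0 <= B by exact: le_trans (normr_ge0 _) (hB point).
have [lB|lB] := leP (l * B) 1; last first.
  rewrite -(mean_cst P (expR (2 * l ^+ 2 * B ^+ 2))); apply: mean_le.
  - exact/bmeas_expR/bmeasZ.
  - exact: bmeas_cst.
  - move=> x; rewrite ler_expR -mulrA -exprMn.
    have h1 : l * (f x - m) <= l * B.
      by rewrite ler_wpM2l// (le_trans (ler_norm _)).
    nra.
apply: (@le_trans _ _ (1 + 2 * l ^+ 2 * B ^+ 2)); last exact: expR_ge1Dx.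
have -> : 1 + 2 * l ^+ 2 * B ^+ 2 =
    \int[P]_x ((1 + 2 * l ^+ 2 * B ^+ 2) + l * (f x - m)).
  rewrite meanD; [|exact: bmeas_cst|exact: bmeasZ].
  by rewrite mean_cst meanZ// meanB// ?mean_cst ?subrr ?mulr0 ?addr0//; exact: bmeas_cst.
apply: mean_le.
- exact/bmeas_expR/bmeasZ.
- by apply: bmeasD; [exact: bmeas_cst|exact: bmeasZ].
- move=> x; have nb : `|l * (f x - m)| <= l * B.
    by rewrite normrM (ger0_norm l0) ler_wpM2l.
  apply: le_trans (expR_le_quadratic (le_trans nb lB)) _.
  have : (l * (f x - m)) ^+ 2 <= (l * B) ^+ 2.
    by rewrite -(real_normK (num_real (l * (f x - m)))) lerXn2r ?nnegrE ?mulr_ge0.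
  rewrite !exprMn; lra.
Qed.

End exponential.

(** * Configurations of independent coordinates *)

Definition cylinder_set (I : eqType) (R : realType) (s : seq I)
    (B : I -> set R) : set (I -> R) :=
  [set x | forall i, i \in s -> B i (x i)].

(** Finitely many coordinates are constrained at once so that the generating
    family is stable under intersection. *)
Definition cylinders (I : eqType) (R : realType) : set (set (I -> R)) :=
  [set C | exists (s : seq I) (B : I -> set R),
    (forall i, measurable (B i)) /\ C = cylinder_set s B].

Local Notation config I R := (g_sigma_algebraType (@cylinders I R)).

Definition update (I : eqType) (R : Type) (x : I -> R) (e : I) (y : R) : I -> R :=
  fun i => if i == e then y else x i.

Definition product_law (I : eqType) (R : realType)
    (Q : probability (config I R) R) (mu : I -> probability R R) :=
  forall (s : seq I) (B : I -> set R), uniq s ->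
    (forall i, measurable (B i)) ->
    Q (cylinder_set s B) = (\prod_(i <- s) mu i (B i))%E.

Section configurations.
Context {I : eqType} {R : realType}.

Lemma cylinders_setI_closed : setI_closed (@cylinders I R).
Proof.
move=> _ _ [s [B [mB ->]]] [t [C [mC ->]]].
exists (s ++ t), (fun i => (if i \in s then B i else setT) `&`
                           (if i \in t then C i else setT)); split.
  by move=> i; apply: measurableI; case: ifP.
apply/seteqP; split => [x [hs ht] i|x h].
  rewrite mem_cat => ist; split.
    by case: ifP => // /hs.
  by case: ifP => // /ht.
split => i hi.
  by have := h i; rewrite mem_cat hi => /(_ isT)[].
by have := h i; rewrite mem_cat hi orbT => /(_ isT)[].
Qed.

Lemma measurable_cylinder_set (s : seq I) (B : I -> set R) :
  (forall i, measurable (B i)) -> measurable (cylinder_set s B : set (config I R)).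
Proof. by move=> mB; apply: sub_sigma_algebra; exists s, B. Qed.

Lemma measurable_coord (i : I) : measurable_fun setT (fun x : config I R => x i).
Proof.
move=> _ B mB; rewrite setTI.
have -> : (fun x : config I R => x i) @^-1` B = cylinder_set [:: i] (fun=> B).
  apply/seteqP; split => x /= => [h j|]; first by rewrite inE => /eqP ->.
  by apply; rewrite mem_head.
exact: measurable_cylinder_set.
Qed.

Lemma measurable_to_config {d} {T : measurableType d} (f : T -> config I R) :
  (forall i, measurable_fun setT (fun w => f w i)) -> measurable_fun setT f.
Proof.
move=> mf; apply: (@measurability _ _ T (config I R) setT f (@cylinders I R)) => //.
move=> _ [_ [s [B [mB ->]]] <-]; rewrite setTI.
elim: s => [|i s ih].
  rewrite [X in measurable X](_ : _ = setT) ?measurableT//.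
  by apply/seteqP; split.
have -> : f @^-1` cylinder_set (i :: s) B =
    (fun w => f w i) @^-1` B i `&` f @^-1` cylinder_set s B.
  apply/seteqP; split => [w h|w [h1 h2] j].
    by split => [|j js]; apply: h; rewrite inE ?eqxx ?js ?orbT.
  by rewrite inE => /orP[/eqP ->//|/h2].
by apply: measurableI => //; rewrite -[X in measurable X]setTI; exact: mf.
Qed.

Lemma measurable_update_pair (e : I) :
  measurable_fun setT (fun p : config I R * R => update p.1 e p.2 : config I R).
Proof.
apply: measurable_to_config => i; rewrite /update.
case: eqP => _; first exact: measurable_snd.
by apply: (measurableT_comp (measurable_coord i)); exact: measurable_fst.
Qed.

Lemma measurable_update (e : I) (y : R) :
  measurable_fun setT (fun x : config I R => update x e y : config I R).
Proof.
exact: (measurableT_comp (@measurable_update_pair e)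
  (measurable_fun_pair (@measurable_id _ _ setT) (@measurable_cst _ _ _ _ setT y))).
Qed.

Lemma measurable_update_at (e : I) (x : config I R) :
  measurable_fun setT (fun y : R => update x e y : config I R).
Proof.
exact: (measurableT_comp (@measurable_update_pair e)
  (measurable_fun_pair (@measurable_cst _ _ _ _ setT x) (@measurable_id _ _ setT))).
Qed.

Lemma update_update (x : I -> R) e y z : update (update x e y) e z = update x e z.
Proof. by apply/funext => i; rewrite /update; case: eqP. Qed.

Lemma updateC (x : I -> R) e e' y z : e != e' ->
  update (update x e y) e' z = update (update x e' z) e y.
Proof.
move=> ne; apply/funext => i; rewrite /update.
by have [->|//] := eqVneq i e'; rewrite eq_sym (negbTE ne).
Qed.

Lemma update_id (x : I -> R) e : update x e (x e) = x.
Proof. by apply/funext => i; rewrite /update; case: eqP => // ->. Qed.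

Variables (Q : probability (config I R) R) (mu : I -> probability R R).
Hypothesis QE : product_law Q mu.

Definition update_mfun (e : I) : {mfun (config I R * R)%type >-> config I R} :=
  HB.pack (fun p : config I R * R => update p.1 e p.2 : config I R)
    (isMeasurableFun.Build _ _ _ _ _ (@measurable_update_pair e)).

(** Replacing one coordinate by an independent copy does not change the law:
    independence detaches the factor of [e] in a cylinder, and cylinders
    determine a probability measure.  All uses of independence go through this
    identity. *)
Lemma resampled_law (e : I) (A : set (config I R)) : measurable A ->
  distribution (Q \x mu e)%E (update_mfun e) A = Q A.
Proof.
move=> mA.
apply: (@measure_unique _ R (config I R) (@cylinders I R) (fun=> setT) erefl
  cylinders_setI_closed _ _ (distribution (Q \x mu e)%E (update_mfun e)) Q) => //.
- move=> _; exists [::], (fun=> setT); split => //.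
  by apply/seteqP; split.
- by rewrite bigcup_const//; exists 0%N.
- move=> _ [s [B [mB ->]]].
  rewrite /distribution /pushforward/=.
  have -> : cylinder_set s B = cylinder_set (undup s) B.
    by apply/seteqP; split => x h i; have := h i; rewrite mem_undup.
  have := undup_uniq s; move: (undup s) => {}s us.
  set C := (X in product_measure1 _ _ X).
  have [es|es] := boolP (e \in s); last first.
    have -> : C = cylinder_set s B `*` setT.
      apply/seteqP; split => -[x y] /=; rewrite /C /cylinder_set /update /=.
        move=> h; split => // i si; have := h i si; case: eqP => // ie.
        by move: es; rewrite -ie si.
      move=> [h _] i si; case: eqP => [ie|_]; last exact: h.
      by move: es; rewrite -ie si.
    rewrite product_measure1E//; last exact: measurable_cylinder_set.

    by rewrite [X in (_ * X)%E](probability_setT (mu e)) mule1.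
  have -> : C = cylinder_set (rem e s) B `*` B e.
    apply/seteqP; split => -[x y] /=; rewrite /C /cylinder_set /update /=.
      move=> h; split => [i|]; last by have := h e es; rewrite eqxx.
      by rewrite mem_rem_uniq// inE => /andP[/negbTE ie si]; have := h i si; rewrite ie.
    move=> [h hy] i si; case: eqP => [->//|/eqP ie].
    by apply: h; rewrite mem_rem_uniq// inE ie.
  rewrite product_measure1E; [|exact: measurable_cylinder_set|exact: mB].
  rewrite [X in (X * _)%E](QE (rem_uniq _ us) mB) [RHS](QE us mB).
  by rewrite (big_rem e es)/= muleC.
- by move=> k; apply: (le_lt_trans (y := 1%E)); [exact: probability_le1|exact: ltry].
Qed.

End configurations.

(** * Averaging over coordinates; Efron-Stein and bounded differences *)

(** Measurability with respect to the coordinates in [s], in a form that does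
    not mention a sigma-algebra. *)
Definition depends_on (I : eqType) (R V : Type) (s : seq I) (g : (I -> R) -> V) :=
  forall x x' : I -> R, {in s, x =1 x'} -> g x = g x'.

Section averaging.
Context {I : eqType} {R : realType}.
Variables (Q : probability (config I R) R) (mu : I -> probability R R).
Implicit Types (g h : config I R -> R) (s : seq I) (e : I) (x : config I R).

Definition avg e g : config I R -> R :=
  fun x => \int[mu e]_y g (update x e y).

(** A version of the conditional expectation of [g] given the coordinates that
    are not in [s]; see [avgs_cond_exp]. *)
Definition avgs s g : config I R -> R := foldr avg g s.

Lemma bmeas_update_at e x g : bmeas g -> bmeas (fun y : R => g (update x e y)).
Proof.
move=> [mg [M hM]]; split; last by exists M => y; exact: hM.
exact: (measurableT_comp mg (measurable_update_at e x)).
Qed.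

Lemma bmeas_update e z g : bmeas g -> bmeas (fun x => g (update x e z)).
Proof.
move=> [mg [M hM]]; split; last by exists M => y; exact: hM.
exact: (measurableT_comp mg (measurable_update e z)).
Qed.

Lemma bmeas_update_pair e g : bmeas g ->
  bmeas (fun p : config I R * R => g (update p.1 e p.2)).
Proof.
move=> [mg [M hM]]; split; last by exists M => y; exact: hM.
exact: (measurableT_comp mg (@measurable_update_pair I R e)).
Qed.

Lemma bmeas_avg e g : bmeas g -> bmeas (avg e g).
Proof.
move=> bg; split.
  have := bmeas_integrable (Q \x mu e)%E (bmeas_update_pair e bg).
  move=> /measurable_fubini_F => m.
  exact: (measurableT_comp (fine_measurable measurableT) m).
have [mg [M hM]] := bg; exists M => x.
apply: le_trans (le_normr_Rintegral _ _) _ => //.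
  exact/bmeas_integrable/bmeas_update_at.
rewrite -[leRHS](mean_cst (mu e)); apply: mean_le => //; last exact: bmeas_cst.
have [mf _] := bmeas_update_at e x bg.
split; first exact: measurableT_comp.
by exists M => y; rewrite normr_id.
Qed.

Lemma bmeas_avgs s g : bmeas g -> bmeas (avgs s g).
Proof. by move=> bg; elim: s => //= e s ih; exact: bmeas_avg. Qed.

Lemma avg_le e g h : bmeas g -> bmeas h -> (forall x, g x <= h x) ->
  forall x, avg e g x <= avg e h x.
Proof. by move=> bg bh gh x; apply: mean_le => //; exact: bmeas_update_at. Qed.

Lemma avgB e g h : bmeas g -> bmeas h ->
  avg e (fun x => g x - h x) = fun x => avg e g x - avg e h x.
Proof.
by move=> bg bh; apply/funext => x; rewrite /avg meanB//; exact: bmeas_update_at.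
Qed.

Lemma avgsB s g h : bmeas g -> bmeas h ->
  avgs s (fun x => g x - h x) = fun x => avgs s g x - avgs s h x.
Proof.
by move=> bg bh; elim: s => //= e s ->; apply: avgB; exact: bmeas_avgs.
Qed.

Lemma sqr_avg_le e g x : bmeas g -> (avg e g x) ^+ 2 <= avg e (fun x => g x ^+ 2) x.
Proof. by move=> bg; apply: sqr_mean_le; exact: bmeas_update_at. Qed.

Lemma sqr_avgs_le s g x : bmeas g ->
  (avgs s g x) ^+ 2 <= avgs s (fun x => g x ^+ 2) x.
Proof.
move=> bg; elim: s x => //= e s ih x.
apply: le_trans (sqr_avg_le _ _ (bmeas_avgs s bg)) _.
by apply: avg_le => //; [exact/bmeas_sqr/bmeas_avgs | exact/bmeas_avgs/bmeas_sqr].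
Qed.

Lemma avg_update_same e g x y : avg e g (update x e y) = avg e g x.
Proof. by apply: eq_Rintegral => z _; rewrite update_update. Qed.

Lemma avgs_update s e g z : e \notin s ->
  avgs s (fun x => g (update x e z)) = fun x => avgs s g (update x e z).
Proof.
elim: s => //= e' s ih; rewrite inE negb_or => /andP[ne es].
rewrite ih//; apply/funext => x; apply: eq_Rintegral => y _.
by rewrite updateC// eq_sym.
Qed.

Lemma avg_depends_on s e g : depends_on (rcons s e) g -> depends_on s (avg e g).
Proof.
move=> dg x x' xx'; apply: eq_Rintegral => y _; apply: dg => i.
rewrite mem_rcons inE /update; case: eqP => //= _; exact: xx'.
Qed.

Lemma avgs_depends_on s t g : depends_on (s ++ t) g -> depends_on s (avgs t g).
Proof.
elim: t s => [|e t ih] s /=; first by rewrite cats0.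
by move=> dg; apply: avg_depends_on; apply: ih; rewrite cat_rcons.
Qed.

Lemma avgs_pull_out s t g k : bmeas g -> depends_on s k -> ~~ has [in s] t ->
  avgs t (fun x => k x * g x) = fun x => k x * avgs t g x.
Proof.
move=> bg dk; elim: t => //= e t ih; rewrite negb_or => /andP[es ts].
rewrite ih//; apply/funext => x; rewrite /avg -meanZ; last first.
  exact/bmeas_update_at/bmeas_avgs.
apply: eq_Rintegral => y _; congr (_ * _); apply: dk => i si.
by rewrite /update; case: eqP => // ie; move: es; rewrite -ie si.
Qed.

Lemma avgs_id s t g : depends_on s g -> ~~ has [in s] t -> avgs t g = g.
Proof.
move=> dg; elim: t => //= e t ih; rewrite negb_or => /andP[es ts].
rewrite ih//; apply/funext => x; rewrite -[RHS](mean_cst (mu e)).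
apply: eq_Rintegral => y _; apply: dg => i si.
by rewrite /update; case: eqP => // ie; move: es; rewrite -ie si.
Qed.

Hypothesis QE : product_law Q mu.

(** Fubini, after which the updated configuration has the law of the
    original one. *)
Lemma mean_avg e g : bmeas g -> \int[Q]_x avg e g x = \int[Q]_x g x.
Proof.
move=> bg; apply: EFin_inj; rewrite !EFin_Rintegral//; last exact: bmeas_avg.
have bp := bmeas_update_pair e bg.
transitivity (\int[Q]_x \int[mu e]_y (g (update x e y))%:E)%E.
  by apply: eq_integral => x _; rewrite EFin_Rintegral//; exact: bmeas_update_at.
have /= -> := integral12_prod_meas1 (bmeas_integrable (Q \x mu e)%E bp).
transitivity (\int[distribution (Q \x mu e)%E (update_mfun e)]_x (g x)%:E)%E.
  rewrite integral_distribution//.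
    by have [mg _] := bg; exact/measurable_EFinP.
  exact: bmeas_integrable.
by apply: eq_measure_integral => A mA _; exact: resampled_law.
Qed.

Lemma mean_avgs s g : bmeas g -> \int[Q]_x avgs s g x = \int[Q]_x g x.
Proof.
move=> bg; elim: s => //= e s <-.
by rewrite (mean_avg e (bmeas_avgs s bg)).
Qed.

Lemma avgs_mean s g x : bmeas g -> depends_on s g ->
  avgs s g x = \int[Q]_x g x.
Proof.
move=> bg dg; rewrite -(mean_avgs s)// -[LHS](mean_cst Q).
by apply: eq_Rintegral => x' _; exact: (@avgs_depends_on [::] s).
Qed.

(** Integrating out one more coordinate [e] splits the second moment around [c]
    into the one of the average and a conditional variance.  The latter is at
    most the second moment around the value at [z], and by Jensen's inequality
    this comparison survives the averages that were taken before. *)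
Lemma efron_stein_step s g c z : uniq s -> bmeas g ->
  \int[Q]_x (g x - c) ^+ 2 <= \int[Q]_x (avgs s g x - c) ^+ 2 +
    \sum_(e <- s) \int[Q]_x (g (update x e z) - g x) ^+ 2.
Proof.
move=> + bg; elim: s => [|e s ih] /=; first by rewrite big_nil addr0.
move=> /andP[es us]; apply: le_trans (ih us) _.
rewrite big_cons addrA lerD2r; set h := avgs s g.
have bh : bmeas h by exact: bmeas_avgs.
have bu : bmeas (fun x => h (update x e z)) by exact: bmeas_update.
have bgu : bmeas (fun x => g (update x e z)) by exact: bmeas_update.
have ba : bmeas (avg e h) by exact: bmeas_avg.
have bhc : bmeas (fun x => (h x - c) ^+ 2) by exact/bmeas_sqr/bmeasB/bmeas_cst.
have bac : bmeas (fun x => (avg e h x - c) ^+ 2).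
  exact/bmeas_sqr/bmeasB/bmeas_cst.
have bd : bmeas (fun x => (h (update x e z) - h x) ^+ 2).
  exact/bmeas_sqr/bmeasB.
have bgd : bmeas (fun x => (g (update x e z) - g x) ^+ 2).
  exact/bmeas_sqr/bmeasB.
apply: (@le_trans _ _ (\int[Q]_x ((avg e h x - c) ^+ 2 +
    avg e (fun x => (h (update x e z) - h x) ^+ 2) x))).
  rewrite -(mean_avg e bhc); apply: mean_le.
  - exact: bmeas_avg.
  - by apply: bmeasD => //; exact: bmeas_avg.
  move=> x; rewrite /avg (mean_sqr_sub (mu e) c (bmeas_update_at e x bh)) /= lerD2l.
  apply: le_trans (mean_sqr_sub_le (mu e) (h (update x e z)) _) _.
    exact: bmeas_update_at.
  rewrite le_eqVlt; apply/orP; left; apply/eqP; apply: eq_Rintegral => y _.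
  by rewrite update_update -sqrrN opprB.
rewrite meanD//; last exact: bmeas_avg.
rewrite lerD2l (mean_avg e bd) -(mean_avgs s bgd); apply: mean_le => //.
  exact: bmeas_avgs.
move=> x; have -> : h (update x e z) - h x =
    avgs s (fun x => g (update x e z) - g x) x.
  by rewrite avgsB// avgs_update.
by apply: sqr_avgs_le; exact: bmeasB.
Qed.

Lemma efron_stein s g z : uniq s -> bmeas g -> depends_on s g ->
  \int[Q]_x (g x - \int[Q]_x g x) ^+ 2 <=
    \sum_(e <- s) \int[Q]_x (g (update x e z) - g x) ^+ 2.
Proof.
move=> us bg dg; set c := \int[Q]_x g x.
apply: le_trans (efron_stein_step c z us bg) _.
rewrite gerDr -[leRHS](mean_cst Q).
rewrite le_eqVlt; apply/orP; left; apply/eqP; apply: eq_Rintegral => x _.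
by rewrite avgs_mean// subrr expr0n.
Qed.

Lemma avgs_oscillation s e g (B : R) : e \notin s -> bmeas g ->
  (forall x y z, `|g (update x e y) - g (update x e z)| <= B) ->
  forall x y z, `|avgs s g (update x e y) - avgs s g (update x e z)| <= B.
Proof.
move=> + bg hB; elim: s => [|e' s ih] //=; rewrite inE negb_or => /andP[ne es] x y z.
have bs := bmeas_avgs s bg.
rewrite /avg -meanB; [|exact: bmeas_update_at|exact: bmeas_update_at].
have bd : bmeas (fun w => avgs s g (update (update x e y) e' w) -
    avgs s g (update (update x e z) e' w)).
  by apply: bmeasB; exact: bmeas_update_at.
have hd w : `|avgs s g (update (update x e y) e' w) -
    avgs s g (update (update x e z) e' w)| <= B.
  by rewrite !(updateC _ _ _ ne); exact: ih.
apply/ler_normlP; split.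
  rewrite lerNl -[leLHS](mean_cst (mu e')); apply: mean_le => //.
    exact: bmeas_cst.
  by move=> w; have /ler_normlP[] := hd w; lra.
rewrite -[leRHS](mean_cst (mu e')); apply: mean_le => //; first exact: bmeas_cst.
by move=> w; have /ler_normlP[] := hd w; lra.
Qed.

Lemma avgs_sub_avg_le s e g (B : R) : e \notin s -> bmeas g ->
  (forall x y z, `|g (update x e y) - g (update x e z)| <= B) ->
  forall x, `|avgs s g x - avg e (avgs s g) x| <= B.
Proof.
move=> es bg hB x; rewrite -{1}(update_id x e).
apply: (@mean_dist_le _ _ _ (mu e) (fun y => avgs s g (update x e y))).
  exact/bmeas_update_at/bmeas_avgs.
by move=> y z; exact: avgs_oscillation.
Qed.

(** One factor [expR (2 l^2 B^2)] is lost for each coordinate integrated out. *)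
Lemma mean_expR_bounded_differences s g (l B : R) : uniq s -> bmeas g ->
  depends_on s g -> 0 <= l ->
  (forall e x y z, e \in s -> `|g (update x e y) - g (update x e z)| <= B) ->
  \int[Q]_x expR (l * g x) <=
    expR (2 * l ^+ 2 * ((size s)%:R * B ^+ 2) + l * \int[Q]_x g x).
Proof.
move=> us bg dg l0 hB.
have key t : uniq t -> {subset t <= s} -> \int[Q]_x expR (l * g x) <=
    expR (2 * l ^+ 2 * ((size t)%:R * B ^+ 2)) *
    \int[Q]_x expR (l * avgs t g x).
  elim: t => [|e t ih] /=; first by rewrite mul0r mulr0 expR0 mul1r.
  move=> /andP[et ut] st; apply: le_trans (ih ut _) _.
    by move=> i it; apply: st; rewrite inE it orbT.
  have -> : 2 * l ^+ 2 * ((size t).+1%:R * B ^+ 2) =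
      2 * l ^+ 2 * ((size t)%:R * B ^+ 2) + 2 * l ^+ 2 * B ^+ 2.
    by rewrite -natr1; ring.
  rewrite expRD -[leRHS]mulrA ler_pM2l ?expR_gt0//.
  have bt := bmeas_avgs t bg.
  have be := bmeas_expR (bmeasZ l bt).
  have ba := bmeas_expR (bmeasZ l (bmeas_avg e bt)).
  rewrite -(mean_avg e be) -meanZ//; apply: mean_le.
  - exact: bmeas_avg.
  - exact: bmeasZ.
  move=> x; apply: (@mean_expR_le _ _ _ (mu e) (fun y => avgs t g (update x e y))) => //.
    exact: bmeas_update_at.
  apply: mean_dist_le; first exact: bmeas_update_at.
  move=> y z; apply: avgs_oscillation => // x' y' z'.
  by apply: hB; apply: st; rewrite inE eqxx.
apply: le_trans (key s us _) _ => //.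
rewrite expRD ler_pM2l ?expR_gt0//.
rewrite le_eqVlt; apply/orP; left; apply/eqP.
rewrite -[RHS](mean_cst Q).
by apply: eq_Rintegral => x _; rewrite avgs_mean.
Qed.

(** Chernoff's bound with [l = h / (4 V)], which minimizes [2 l^2 V - l h]. *)
Lemma bounded_differences s g (B V h : R) : uniq s -> bmeas g ->
  depends_on s g ->
  (forall e x y z, e \in s -> `|g (update x e y) - g (update x e z)| <= B) ->
  (size s)%:R * B ^+ 2 <= V -> 0 < V -> 0 <= h ->
  (Q [set x | (h <= g x - \int[Q]_x g x)%R] <= (expR (- (h ^+ 2 / (8 * V))))%:E)%E.
Proof.
move=> us bg dg hB hV V0 h0; set m := \int[Q]_x g x.
pose A : set (config I R) := [set x | (h <= g x - m)%R].
have mA : measurable A.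
  have [mg _] := bmeasB bg (bmeas_cst m).
  have -> : A = setT `&` (fun x => g x - m) @^-1` `[h, +oo[.
    by rewrite setTI; apply/seteqP; split => x; rewrite /A/= in_itv/= andbT.
  exact: mg.
rewrite -/A -[X in (X <= _)%E]fineK ?fin_num_measure//.
rewrite lee_fin -mean_indic//.
pose l := h / (4 * V).
have l0 : 0 <= l by rewrite /l divr_ge0// mulr_ge0// ltW.
apply: (@le_trans _ _ (\int[Q]_x (expR (- (l * (m + h))) * expR (l * g x)))).
  apply: mean_le => [||x].
  - exact: bmeas_indic.
  - exact/bmeasZ/bmeas_expR/bmeasZ.
  rewrite -expRD indicE; have [|_] := boolP (x \in A); last exact: expR_ge0.
  rewrite inE /A/= => hx; rewrite -expR0 ler_expR.
  have -> : - (l * (m + h)) + l * g x = l * (g x - m - h) by ring.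
  by rewrite mulr_ge0// subr_ge0.
rewrite meanZ; last exact/bmeas_expR/bmeasZ.
apply: (@le_trans _ _ (expR (- (l * (m + h))) *
    expR (2 * l ^+ 2 * ((size s)%:R * B ^+ 2) + l * m))).
  by rewrite ler_pM2l ?expR_gt0//; exact: mean_expR_bounded_differences.
rewrite -expRD ler_expR.
have h1 : 2 * l ^+ 2 * ((size s)%:R * B ^+ 2) <= 2 * l ^+ 2 * V.
  by rewrite ler_wpM2l// mulr_ge0// sqr_ge0.
have h2 : 2 * l ^+ 2 * V - l * h = - (h ^+ 2 / (8 * V)).
  by rewrite /l; field; rewrite gt_eqF.
lra.
Qed.

End averaging.

(** * Kesten's inequality for functions of independent coordinates *)

Section martingale.
Context {I : eqType} {R : realType}.
Variables (Q : probability (config I R) R) (mu : I -> probability R R).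
Hypothesis QE : product_law Q mu.
Implicit Types (g : config I R -> R) (s t : seq I) (e : I) (x : config I R).

(** Describing the information in the coordinates of [s] by invariance rather
    than by generators makes the filtration axioms immediate. *)
Definition sigma_of (s : seq I) : set (set (config I R)) :=
  [set A : set (config I R) | measurable A /\ depends_on s (fun x : I -> R => A x)].

Lemma sigma_of_sigma_algebra s : sigma_algebra setT (sigma_of s).
Proof.
split.
- by split; [exact: measurable0|].
- move=> A [mA dA]; rewrite setTD; split; first exact: measurableC.
  by move=> x x' /dA h; rewrite /setC/= h.
- move=> A hA; split; first by apply: bigcup_measurable => n _; exact: (hA n).1.
  move=> x x' xx'; apply/propext; split=> -[n _ h]; exists n => //.
    by rewrite -((hA n).2 _ _ xx').
  by rewrite ((hA n).2 _ _ xx').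
Qed.

Lemma sigma_of_sub s t : {subset s <= t} -> sigma_of s `<=` sigma_of t.
Proof.
move=> st A [mA dA]; split=> // x x' h; apply: dA => i /st; exact: h.
Qed.

(** Multiplication by the indicator of an event that depends on [s] commutes
    with averaging over [t], and averaging preserves means. *)
Lemma avgs_cond_exp s t g : ~~ has [in s] t -> bmeas g ->
  depends_on (s ++ t) g -> is_cond_exp Q (sigma_of s) g (avgs mu t g).
Proof.
move=> st bg dg; have ba := bmeas_avgs Q mu t bg.
split; [exact: bmeas_integrable|exact: bmeas_integrable| |].
  move=> B mB; split; first by have [ma _] := ba; rewrite -[X in measurable X]setTI; exact: ma.
  by move=> x x' h; rewrite /preimage/= (avgs_depends_on mu dg h).
move=> A [mA dA]; rewrite integral_mkcond [RHS]integral_mkcond.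
have bA := bmeas_indic (R := R) mA.
have hA (f : config I R -> R) : bmeas f ->
    (\int[Q]_x (((fun x => (f x)%:E) \_ A) x) = (\int[Q]_x ((\1_A x : R) * f x)%R)%:E)%E.
  move=> bf; rewrite EFin_Rintegral; last exact: bmeasM.
  apply: eq_integral => x _; rewrite patchE indicE.
  by case: (x \in A); rewrite ?mul1r ?mul0r.
rewrite !hA//; congr EFin.
have dA' : depends_on s (\1_A : config I R -> R).
  move=> x x' /dA /= h; rewrite !indicE.
  by have -> : (x \in A) = (x' \in A) by apply/idP/idP; rewrite !inE h.
rewrite -(mean_avgs QE t (bmeasM bA bg)) (avgs_pull_out Q mu bg dA' st).
by [].
Qed.


Lemma uniq_drop_take s n : uniq s -> ~~ has [in take n s] (drop n s).
Proof. by rewrite -{1}(cat_take_drop n s) cat_uniq => /and3P[]. Qed.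

Lemma nth_notin_drop (e0 : I) s n : uniq s -> (n < size s)%N ->
  nth e0 s n \notin drop n.+1 s.
Proof. by move=> /(drop_uniq n) + ns; rewrite (drop_nth e0 ns) => /andP[]. Qed.

Lemma avgs_drop_depends_on s g n : depends_on s g ->
  depends_on (take n s) (avgs mu (drop n s) g).
Proof. by move=> dg; apply: avgs_depends_on; rewrite cat_take_drop. Qed.

Lemma avgs_drop_nth e0 s g n : (n < size s)%N ->
  avgs mu (drop n s) g = avg mu (nth e0 s n) (avgs mu (drop n.+1 s) g).
Proof. by move=> ns; rewrite (drop_nth e0 ns). Qed.

Lemma avgs_drop_martingale e0 s g : uniq s -> bmeas g -> depends_on s g ->
  martingale Q (fun n => sigma_of (take n s)) (fun n => avgs mu (drop n s) g).
Proof.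
move=> us bg dg n; have [ns|ns] := ltnP n (size s).
  rewrite (avgs_drop_nth e0 g ns).
  apply: (@avgs_cond_exp _ [:: nth e0 s n]).
  - have := uniq_drop_take n us; rewrite (drop_nth e0 ns)/= !negb_or => /andP[-> _].
    by [].
  - exact: bmeas_avgs.
  - by rewrite cats1 -take_nth//; exact: avgs_drop_depends_on.
rewrite !drop_oversize//; last exact: leqW.
apply: (@avgs_cond_exp _ [::]) => //.
by rewrite cats0 take_oversize.
Qed.

(** The martingale reveals the coordinates of [s] in order.  Its increment at
    [e] is centred given the past, so its conditional second moment is at most
    the one around the value with [z] at [e]; by Jensen's inequality
    the latter is at most the conditional mean of the squared change of [g]
    itself.  The element [e0] is a default value for [nth]. *)
Lemma kesten_bounded_differences (e0 : I) s g (z c1 c2 B1 C1 C2 s0 : R) :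
  kesten_constants c1 c2 -> uniq s -> bmeas g -> depends_on s g ->
  (forall e x y w, e \in s -> `|g (update x e y) - g (update x e w)| <= B1) ->
  0 < C1 -> 0 < C2 -> 0 < s0 -> expR 2 * B1 ^+ 2 <= s0 -> 0 <= B1 ->
  (forall t : R, s0 <= t ->
    (Q [set x | (t < \sum_(e <- s) (g (update x e z) - g x) ^+ 2)%R] <=
      (C1 * expR (- (C2 * t ^+ 2)))%:E)%E) ->
  forall t : R, 0 < t ->
    (Q [set x | (t < `|g x - \int[Q]_y g y|)%R] <=
      (c1 * (1 + C1 + C1 / (s0 ^+ 2 * C2)) *
       expR (- (c2 * (t / (Num.sqrt s0 + (t / (s0 * C2)) `^ (3^-1))))))%:E)%E.
Proof.
move=> [_ _ kesten] us bg dg hB C10 C20 s00 hs0 B10 htail t t0.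
pose M n := avgs mu (drop n s) g.
pose u k x := if k is k'.+1 then
  if (k' < size s)%N then (g (update x (nth e0 s k') z) - g x) ^+ 2 else 0 else 0.
have bu k : bmeas (u k).
  case: k => [|k]; first exact: bmeas_cst.
  rewrite /u; case: ltnP => _; last exact: bmeas_cst.
  exact/bmeas_sqr/bmeasB/bg/bmeas_update.
pose U k : {RV Q >-> R} := HB.pack (u k)
  (isMeasurableFun.Build _ _ _ _ (u k) (bu k).1).
pose G : {RV Q >-> R} := HB.pack g (isMeasurableFun.Build _ _ _ _ g bg.1).
have bM n : bmeas (M n) by exact: bmeas_avgs.
have M0 x : M 0%N x = \int[Q]_y g y by rewrite /M drop0 (avgs_mean QE).
have sumU x : (\sum_(1 <= k <oo) (u k x)%:E =
    (\sum_(e <- s) (g (update x e z) - g x) ^+ 2)%:E)%E.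
  rewrite (@nneseries_split _ _ 1 (size s)); last first.
    by move=> k _; rewrite lee_fin /u; case: k => // k; case: ifP => // _; exact: sqr_ge0.
  rewrite [X in (_ + X)%E]eseries0 ?adde0; last first.
    by move=> k; rewrite add1n /u; case: k => // k; rewrite ltnS => ks _; rewrite ltnNge ks.
  rewrite sumEFin; congr EFin; rewrite (big_nth e0) add1n big_add1/=.
  by apply: eq_big_nat => k /andP[_ ks]; rewrite /u ks.
have := kesten _ (config I R) Q (fun n => sigma_of (take n s)) M G U B1 C1 C2 s0.
have -> : [set x | (t < `|g x - \int[Q]_y g y|)%R] =
    [set x | (t < `|G x - M 0%N x|)%R].
  by apply/seteqP; split => x /=; rewrite M0.
apply => //.
- split => n.
  + exact: sigma_of_sigma_algebra.
  + by move=> A [].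
  + apply: sigma_of_sub => i.
    have [ns|ns] := ltnP n (size s).
      by rewrite (take_nth e0 ns) mem_rcons inE => ->; rewrite orbT.
    by rewrite !take_oversize//; exact: leqW.
- exact: avgs_drop_martingale.
- apply: aeW => x; apply: (@cvg_near_cst _ _ _ (fun n => M n x)).
  by near=> n; rewrite /M drop_oversize//; near: n; exact: nbhs_infty_ge.
- move=> k; apply: aeW => x; rewrite /M.
  have [ks|ks] := ltnP k (size s); last first.
    by rewrite !drop_oversize ?subrr ?normr0//; exact: leqW.
  rewrite (avgs_drop_nth e0 g ks); apply: (avgs_sub_avg_le Q).
  - exact: nth_notin_drop.
  - exact: bg.
  - by move=> ? ? ?; apply: hB; exact: mem_nth.
- move=> k x; rewrite /U/= /u; case: k => // k; case: ifP => // _; exact: sqr_ge0.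
- move=> k.
  pose D x := (M k.+1 x - M k x) ^+ 2.
  have bD : bmeas D by exact/bmeas_sqr/bmeasB.
  exists (avgs mu (drop k s) D), (avgs mu (drop k s) (u k.+1)); split.
  + apply: avgs_cond_exp => //; first exact: uniq_drop_take.
    rewrite cat_take_drop /D => x x' h.
    have h1 n : M n x = M n x'.
      by apply: (avgs_drop_depends_on dg) => i /mem_take; exact: h.
    by rewrite !h1.
  + suff : is_cond_exp Q (sigma_of (take k s)) (u k.+1)
        (avgs mu (drop k s) (u k.+1)) by [].
    apply: avgs_cond_exp => //; first exact: uniq_drop_take.
    rewrite cat_take_drop /u => x x' h.
    case: ifP => // ks; congr ((_ - _) ^+ 2); apply: dg => // i si.
    by rewrite /update; case: ifP => // _; exact: h.
  + apply: aeW => x.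
    have [ks|ks] := ltnP k (size s); last first.
      rewrite /u ltnNge ks/= /D /M !drop_oversize//=; last exact: leqW.
      by rewrite subrr expr0n.
    set e := nth e0 s k.
    have dk : drop k s = e :: drop k.+1 s by exact: drop_nth.
    have ek : e \notin drop k.+1 s by exact: nth_notin_drop.
    have dD : depends_on (take k.+1 s) D.
      move=> y y' h; rewrite /D.
      have -> : M k.+1 y = M k.+1 y' by exact: (avgs_drop_depends_on dg).
      have -> // : M k y = M k y'.
      apply: (avgs_drop_depends_on dg) => i hi; apply: h.
      by rewrite (take_nth e0 ks) mem_rcons inE hi orbT.
    have bdiff : bmeas (fun y : config I R => (M k.+1 (update y e z) - M k.+1 y) ^+ 2).
      exact/bmeas_sqr/bmeasB/bM/bmeas_update.
    rewrite dk /= (avgs_id mu dD (uniq_drop_take k.+1 us)).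
    apply: (@le_trans _ _ (avg mu e
        (fun y : config I R => (M k.+1 (update y e z) - M k.+1 y) ^+ 2) x)).
      have -> : avg mu e D x =
          \int[mu e]_y (M k.+1 (update x e y) - avg mu e (M k.+1) x) ^+ 2.
        apply: eq_Rintegral => y _; rewrite /D.
        by rewrite {2}/M (avgs_drop_nth e0 g ks) -/e avg_update_same.
      have bup := bmeas_update_at e x (bM k.+1).
      apply: le_trans (mean_sqr_sub_le (mu e) (M k.+1 (update x e z)) bup) _.
      rewrite le_eqVlt; apply/orP; left; apply/eqP; apply: eq_Rintegral => y _.
      by rewrite update_update -sqrrN opprB.
    apply: avg_le => //; first exact: bmeas_avgs.
    move=> y; rewrite /u ks -/e.
    have -> : M k.+1 (update y e z) - M k.+1 y =
        avgs mu (drop k.+1 s) (fun x : config I R => g (update x e z) - g x) y.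
      by rewrite (avgsB Q mu) ?avgs_update//; exact: bmeas_update.
    by apply: (sqr_avgs_le Q mu); apply: bmeasB => //; exact: bmeas_update.
- move=> r hr; apply: le_trans (htail r hr).
  rewrite le_eqVlt; apply/orP; left; apply/eqP; congr (Q _).
  by apply/seteqP; split => x /=; rewrite sumU lte_fin.
Unshelve. all: by end_near.
Qed.

End martingale.

(** * Edges, potentials and energy in a box *)

Section edges.
Variables (d N : nat).

Definition edges : seq (edge d) :=
  finmap.enum_fset (fset_set (box_edges d N)).

Lemma uniq_edges : uniq edges.
Proof. exact: finmap.fset_uniq. Qed.

Lemma mem_edges e : (e \in edges) = (e \in box_edges d N).
Proof. by rewrite /edges (in_fset_set (finite_box_edges d N)). Qed.

Lemma energyE (R : realType) (c : edge d -> R) (u v : site d -> R) :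
  energy N c u v = \sum_(e <- edges)
    c e * (u (src e) - u (tgt e)) * (v (src e) - v (tgt e)).
Proof. by rewrite /energy (fsbig_finite _ _ (finite_box_edges d N)). Qed.

Lemma box_cbox x : box d N x -> cbox d N x.
Proof. by move=> h i; have := h i; lia. Qed.

Lemma edges_cbox e : e \in edges -> cbox d N (src e) /\ cbox d N (tgt e).
Proof.
by rewrite mem_edges inE => -[[/box_cbox ? ?]|[? /box_cbox ?]].
Qed.

(** Every edge has an endpoint in the box, which is either its source or its
    target; each case leaves [d * N ^ d] possibilities. *)
Lemma size_edges : (size edges <= 2 * d * N ^ d)%N.
Proof.
pose pt (f : {ffun 'I_d -> 'I_N}) : site d := \row_j ((f j).+1)%:Z.
pose F := [seq (f, i) | f <- enum {ffun 'I_d -> 'I_N}, i <- enum 'I_d].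
pose L : seq (edge d) := [seq (pt p.1, p.2) | p <- F] ++
  [seq (pt p.1 - delta_mx 0 p.2, p.2) | p <- F].
have sL : size L = (2 * d * N ^ d)%N.
  rewrite size_cat !size_map size_allpairs -!cardE card_ffun !card_ord; lia.
rewrite -sL; apply: (uniq_leq_size uniq_edges) => -[x i].
rewrite mem_edges inE => h.
have ptE y : box d N y -> exists f, y = pt f.
  move=> hy; have hb (j : 'I_d) : ((absz (y 0%R j)).-1 < N)%N by have := hy j; lia.
  exists [ffun j => Ordinal (hb j)].
  apply/rowP => j; rewrite mxE ffunE /=; have := hy j; lia.
have memF f j : (f, j) \in F.
  by apply/allpairsP; exists (f, j); rewrite !mem_enum.
rewrite mem_cat; case: h => -[].
  move=> /ptE[f xf] _; apply/orP; left; apply/mapP; exists (f, i) => //=.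
  by rewrite -xf.
move=> _ /ptE[f xf]; apply/orP; right; apply/mapP; exists (f, i) => //=.
by rewrite -xf /tgt/= addrK.
Qed.

End edges.

Section potentials.
Context {R : realType} {d N : nat}.
Implicit Types (c : edge d -> R) (u v : site d -> R).

Definition gradient u (e : edge d) : R := u (src e) - u (tgt e).

Lemma energy_gradient c u :
  energy N c u u = \sum_(e <- edges d N) c e * gradient u e ^+ 2.
Proof. by rewrite energyE; apply: eq_bigr => e _; rewrite -mulrA. Qed.

Lemma potentials_comp u (phi : R -> R) : phi 0 = 0 -> phi (N%:R + 1) = N%:R + 1 ->
  potentials R d N u -> potentials R d N (phi \o u).
Proof.
move=> p0 p1 [h0 h1 h2]; split => [x bx cx|x bx cx|x y xy bx cx cx' by_] /=.
- by rewrite h0.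
- by rewrite h1.
- by rewrite (h2 x y).
Qed.

Lemma potentials_ext u v : (forall x, cbox d N x -> u x = v x) ->
  potentials R d N u -> potentials R d N v.
Proof.
move=> uv [h0 h1 h2]; split => [x bx cx|x bx cx|x y xy bx cx cx' by_].
- by rewrite -uv ?h0//; case: bx.
- by rewrite -uv ?h1//; case: bx.
- have [cx0 _] := bx; rewrite -(uv _ cx0) -(uv _ (box_cbox by_)); exact: h2.
Qed.

Lemma energy_ext c u v : (forall x, cbox d N x -> u x = v x) ->
  energy N c u u = energy N c v v.
Proof.
move=> uv; rewrite !energy_gradient !big_seq; apply: eq_bigr => e /edges_cbox[hs ht].
by rewrite /gradient !uv.
Qed.

Lemma coord1E (d0 : (0 < d)%N) (x : site d) : coord1 x = x 0 (Ordinal d0).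
Proof. by rewrite /coord1 insubT. Qed.

(** A lateral boundary point and its neighbour in the box differ in a coordinate
    other than the first: otherwise the boundary point would be in the box. *)
Lemma coord1_potential : (0 < d)%N ->
  potentials R d N (fun x => (coord1 x)%:~R).
Proof.
move=> d0; split => [x _ ->//|x _ ->|x y xy bx].
  by rewrite intrD.
rewrite !(coord1E d0); set i := Ordinal d0 => x0 x1 by_; congr (_%:~R).
have [cx nbx] := bx.
have key (e : edge d) (s : int) : s = 1 \/ s = -1 ->
    (forall j, x 0 j = y 0 j + s * (j == e.2)%:Z) -> x 0 i = y 0 i.
  move=> hs h; have [ie|/negbTE ie] := eqVneq i e.2; last by rewrite h ie mulr0 addr0.
  exfalso; apply: nbx => j; have := cx j; have := by_ j; have := h j.
  have [ji|/negbTE ji] := eqVneq j i; last by rewrite -ie ji mulr0 addr0 => ->.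
  by rewrite ji; lia.
move/adjP : xy => [e [[xe ye]|[xe ye]]].
  by apply: (key e (-1)); [right|move=> j; rewrite xe ye tgtE; lia].
by apply: (key e 1); [left|move=> j; rewrite xe ye tgtE mul1r].
Qed.

Lemma energy_ge0 c u : (forall e, 0 <= c e) -> 0 <= energy N c u u.
Proof.
move=> c0; rewrite energy_gradient sumr_ge0// => e _.
by rewrite mulr_ge0// sqr_ge0.
Qed.

Definition min_energy c : R := inf [set energy N c u u | u in potentials R d N].

Lemma eff_condE c : eff_cond N c = (N%:R ^+ d)^-1 * min_energy c.
Proof. by []. Qed.

Lemma has_inf_energy c : (0 < d)%N -> (forall e, 0 <= c e) ->
  has_inf [set energy N c u u | u in potentials R d N].
Proof.
move=> d0 c0; split.
  by exists (energy N c (fun x => (coord1 x)%:~R) (fun x => (coord1 x)%:~R));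
    exists (fun x => (coord1 x)%:~R) => //; exact: coord1_potential.
by exists 0 => _ [u _ <-]; exact: energy_ge0.
Qed.

Lemma min_energy_le c u : (forall e, 0 <= c e) -> potentials R d N u ->
  min_energy c <= energy N c u u.
Proof.
move=> c0 pu; apply: ge_inf; last by exists u.
by exists 0 => _ [v _ <-]; exact: energy_ge0.
Qed.

Lemma le_min_energy c r : (0 < d)%N ->
  (forall u, potentials R d N u -> r <= energy N c u u) -> r <= min_energy c.
Proof.
move=> d0 h; apply: lb_le_inf; last by move=> _ [u pu <-]; exact: h.
by exists (energy N c (fun x => (coord1 x)%:~R) (fun x => (coord1 x)%:~R));
    exists (fun x => (coord1 x)%:~R) => //; exact: coord1_potential.
Qed.

Lemma min_energy_ge0 c : (0 < d)%N -> (forall e, 0 <= c e) -> 0 <= min_energy c.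
Proof. by move=> d0 c0; apply: le_min_energy => // u _; exact: energy_ge0. Qed.

(** The test potential is the first coordinate, whose gradients are 0 or -1. *)
Lemma min_energy_le_size c (k : R) : (0 < d)%N -> (forall e, 0 <= c e <= k) ->
  min_energy c <= k * (size (edges d N))%:R.
Proof.
move=> d0 ck; have c0 e : 0 <= c e by have /andP[] := ck e.
apply: le_trans (min_energy_le c0 (coord1_potential d0)) _.
rewrite energy_gradient mulr_natr -iter_addr_0 -(count_predT (edges d N)).
rewrite -big_const_seq; apply: ler_sum => e _.
have /andP[_ hk] := ck e; rewrite -[leRHS]mulr1; apply: ler_pM => //.
  exact: sqr_ge0.
rewrite /gradient !(coord1E d0) tgtE intrD opprD addrA subrr sub0r sqrrN.
by case: (_ == _); rewrite ?expr1n ?expr0n ?ler01.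
Qed.

(** Truncating a potential to the range of its boundary values contracts its
    gradient, so that near-minimizers may be taken with values in
    [0, N + 1]. *)
Lemma near_minimizer c (eps : R) : (0 < d)%N -> (forall e, 0 <= c e) -> 0 < eps ->
  exists2 u, potentials R d N u &
    energy N c u u <= min_energy c + eps /\ forall e, `|gradient u e| <= N%:R + 1.
Proof.
move=> d0 c0 eps0; have [_ [v pv <-] hv] := inf_adherent eps0 (has_inf_energy d0 c0).
pose phi (y : R) := Num.max 0 (Num.min y (N%:R + 1)).
have N0 : 0 <= N%:R :> R by exact: ler0n.
have phi_lip y z : `|phi y - phi z| <= `|y - z|.
  rewrite /phi /Num.max /Num.min; do ! case: ifPn; rewrite -?leNgt => *;
    rewrite ler_norml; apply/andP; split; have := ler_norm (y - z);
    have := ler_norm (z - y); rewrite (distrC z y); lra.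
have phi_itv y : 0 <= phi y <= N%:R + 1.
  rewrite /phi /Num.max /Num.min; do ! case: ifPn; rewrite -?leNgt => *; lra.
exists (phi \o v).
  apply: potentials_comp => //; rewrite /phi /Num.max /Num.min;
  do ! case: ifPn; rewrite -?leNgt => *; lra.
split.
  apply: (@le_trans _ _ (energy N c v v)); last exact: ltW.
  rewrite !energy_gradient; apply: ler_sum => e _; apply: ler_wpM2l => //.
  rewrite -(real_normK (num_real (gradient (phi \o v) e))).
  rewrite -(real_normK (num_real (gradient v e))).
  by rewrite lerXn2r ?nnegrE//; exact: phi_lip.
move=> e; have := phi_itv (v (src e)); have := phi_itv (v (tgt e)).
by rewrite /gradient/= ler_norml; lra.
Qed.

End potentials.

(** * Raising one conductance; rational potentials *)

Section increments.
Context {R : realType} {d N : nat}.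
Hypothesis d_gt0 : (0 < d)%N.
Variables (kappa : R) (c : edge d -> R).
Hypothesis c_bound : forall e, 0 < c e <= kappa.

Let c_ge0 e : 0 <= c e.
Proof. by have /andP[/ltW] := c_bound e. Qed.

Let kappa_gt0 : 0 < kappa.
Proof.
have /andP[h1 h2] := c_bound ((0 : site d), Ordinal d_gt0).
exact: lt_le_trans h1 h2.
Qed.

Let update_ge0 e f : 0 <= update c e kappa f.
Proof. by rewrite /update; case: ifP => // _; exact: ltW. Qed.

Let M := @min_energy R d N.

Lemma min_energy_update_ge e : M c <= M (update c e kappa).
Proof.
apply: le_min_energy => // u pu; apply: le_trans (min_energy_le c_ge0 pu) _.
rewrite !energy_gradient; apply: ler_sum => f _.
rewrite ler_wpM2r ?sqr_ge0// /update; case: eqP => // ->.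
by have /andP[] := c_bound e.
Qed.

(** The potential [u] is a competitor for the increased conductances, and only
    the term of [e] changes. *)
Lemma min_energy_update_le e u : e \in edges d N -> potentials R d N u ->
  M (update c e kappa) <= energy N c u u + kappa * gradient u e ^+ 2.
Proof.
move=> he pu; apply: le_trans (min_energy_le (update_ge0 e) pu) _.
rewrite !energy_gradient (bigD1_seq e)//= ?uniq_edges//.
rewrite [X in _ <= X + _](bigD1_seq e)//= ?uniq_edges//.
rewrite {1}/update eqxx.
have -> : \sum_(i <- edges d N | i != e) update c e kappa i * gradient u i ^+ 2 =
    \sum_(i <- edges d N | i != e) c i * gradient u i ^+ 2.
  by apply: eq_bigr => i /negbTE ie; rewrite /update ie.
have : 0 <= c e * gradient u e ^+ 2 by rewrite mulr_ge0// sqr_ge0.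
lra.
Qed.

Lemma min_energy_increment_le e : e \in edges d N ->
  M (update c e kappa) - M c <= kappa * (N%:R + 1) ^+ 2.
Proof.
move=> he; rewrite lerBlDl; apply/ler_addgt0Pr => eps eps0.
have [u pu [hu gu]] := near_minimizer (N := N) d_gt0 c_ge0 eps0.
apply: le_trans (min_energy_update_le he pu) _.
have : kappa * gradient u e ^+ 2 <= kappa * (N%:R + 1) ^+ 2.
  rewrite ler_wpM2l//; first exact: ltW.
  by rewrite -(real_normK (num_real (gradient u e))) lerXn2r ?nnegrE ?addr_ge0.
rewrite -/M in hu; lra.
Qed.

(** One factor of the fourth power is bounded uniformly.  For the other one,
    either [1 <= s * c e], and the edge pays with its energy, or the edge is
    weak and the uniform bound is used again. *)
Lemma sum_gradient4_le (s : R) u : 0 <= s ->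
  (forall e, `|gradient u e| <= N%:R + 1) ->
  \sum_(e <- edges d N) (gradient u e ^+ 2) ^+ 2 <= (N%:R + 1) ^+ 2 *
    (s * energy N c u u +
     (N%:R + 1) ^+ 2 * \sum_(e <- edges d N) ((s <= (c e)^-1)%R)%:R).
Proof.
move=> s0 gu; rewrite energy_gradient !mulr_sumr -big_split mulr_sumr /=.
apply: ler_sum => e _; set g := gradient u e ^+ 2.
have g0 : 0 <= g by exact: sqr_ge0.
have gN : g <= (N%:R + 1) ^+ 2.
  by rewrite /g -(real_normK (num_real (gradient u e))) lerXn2r ?nnegrE ?addr_ge0.
rewrite expr2; apply: ler_pM => //.
have /andP[c0 _] := c_bound e.
have [sc|sc] := leP s (c e)^-1.
  by rewrite mulr1; apply: le_trans gN _; rewrite lerDr mulr_ge0// mulr_ge0.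
rewrite mulr0 addr0 mulrA -[leLHS]mul1r ler_wpM2r//.
by rewrite -ler_pdivrMr// div1r ltW.
Qed.

(** The same potential [u] controls the increments at all edges, so that the
    sum of their squares is bounded by a sum of fourth powers of gradients.  Near-minimizers
    with error [eps -> 0] take the place of the minimizer. *)
Lemma sum_sqr_min_energy_increment_le (s : R) : 0 <= s ->
  \sum_(e <- edges d N) (M (update c e kappa) - M c) ^+ 2 <=
    kappa ^+ 2 * ((N%:R + 1) ^+ 2 * (s * (kappa * (size (edges d N))%:R) +
     (N%:R + 1) ^+ 2 * \sum_(e <- edges d N) ((s <= (c e)^-1)%R)%:R)).
Proof.
move=> s0; set L : R := (N%:R + 1) ^+ 2; set Z := (\sum_(e <- _) _%:R).
set n : R := (size (edges d N))%:R.
have L0 : 0 <= L by exact: sqr_ge0.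
have n0 : 0 <= n by exact: ler0n.
pose K := kappa ^+ 2 * L * s + n * (2 * kappa * L + 1).
have k0 := ltW kappa_gt0.
have K0 : 0 <= K.
  rewrite /K addr_ge0// mulr_ge0//; last by rewrite addr_ge0// !mulr_ge0.
  by rewrite mulr_ge0// sqr_ge0.
have key eps : 0 < eps -> eps <= 1 ->
    \sum_(e <- edges d N) (M (update c e kappa) - M c) ^+ 2 <=
    kappa ^+ 2 * (L * (s * (kappa * n) + L * Z)) + eps * K.
  move=> eps0 eps1.
  have [u pu [hu gu]] := near_minimizer (N := N) d_gt0 c_ge0 eps0.
  apply: (@le_trans _ _ (\sum_(e <- edges d N)
      (kappa ^+ 2 * (gradient u e ^+ 2) ^+ 2 + eps * (2 * kappa * L + 1)))).
    rewrite !big_seq; apply: ler_sum => e he; set g := gradient u e ^+ 2.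
    have g0 : 0 <= g by exact: sqr_ge0.
    have gN : g <= L.
      by rewrite /g -(real_normK (num_real (gradient u e))) lerXn2r ?nnegrE ?addr_ge0.
    have h1 : M (update c e kappa) - M c <= kappa * g + eps.
      have := min_energy_update_le he pu; rewrite -/g; rewrite -/M in hu; lra.
    have h0 : 0 <= M (update c e kappa) - M c.
      by rewrite subr_ge0 min_energy_update_ge.
    apply: (@le_trans _ _ ((kappa * g + eps) ^+ 2)).
      by rewrite lerXn2r ?nnegrE// (le_trans h0).
    have h2 : kappa * g * eps <= kappa * L * eps.
      by rewrite ler_wpM2r ?(ltW eps0)// ler_wpM2l.
    have h3 : eps ^+ 2 <= eps by rewrite expr2 ler_piMl// ltW.
    nra.
  rewrite big_split /= -mulr_sumr.
  rewrite big_const_seq count_predT iter_addr_0 -[X in _ + X]mulr_natr -/n.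
  have h4 : kappa ^+ 2 * \sum_(e <- edges d N) (gradient u e ^+ 2) ^+ 2 <=
      kappa ^+ 2 * (L * (s * (kappa * n + eps) + L * Z)).
    rewrite ler_wpM2l ?sqr_ge0//.
    apply: le_trans (sum_gradient4_le s0 gu) _.
    rewrite ler_wpM2l// lerD2r ler_wpM2l//.
    apply: le_trans hu _; rewrite lerD2r.
    by apply: min_energy_le_size => // e; have /andP[/ltW -> ->] := c_bound e.
  apply: le_trans (lerD h4 (lexx _)) _.
  rewrite le_eqVlt; apply/orP; left; apply/eqP; rewrite /K; ring.
apply/ler_addgt0Pr => del del0.
(* The [+ 1] avoids a case distinction when [K = 0]. *)
pose eps := Num.min 1 (del / (K + 1)).
have eps0 : 0 < eps by rewrite /eps lt_min ltr01/= divr_gt0// ltr_wpDl.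
have eps1 : eps <= 1 by rewrite /eps ge_min lexx.
apply: le_trans (key eps eps0 eps1) _; rewrite lerD2l.
have h : eps <= del / (K + 1) by rewrite /eps ge_min lexx orbT.
have h2 : eps * (K + 1) <= del by rewrite -ler_pdivlMr// ltr_wpDl.
apply: le_trans h2; rewrite ler_wpM2l// ?(ltW eps0)//; lra.
Qed.

End increments.

Section measurability.
Context {R : realType} {d N : nat}.
Hypothesis d_gt0 : (0 < d)%N.

(** Rational-valued functions on the closed box; the point is that this type is
    countable. *)
Definition grid := {ffun {ffun 'I_d -> 'I_N.+2} -> rat}.

Definition grid_fun (q : grid) : site d -> R :=
  fun x => ratr (q [ffun i => inord (absz (x 0 i))]).

(** Rounding the values of a potential down to multiples of [1 / m] fixes the
    integers and preserves equalities between values, hence preserves the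
    boundary conditions; it changes every gradient by at most [1 / m].  The
    infimum may thus be taken over countably many potentials. *)
Lemma grid_approx (c : edge d -> R) (r : R) : (forall e, 0 <= c e) ->
  min_energy (N := N) c < r <->
  exists2 q : grid, potentials R d N (grid_fun q) &
    energy N c (grid_fun q) (grid_fun q) < r.
Proof.
move=> c0; split; last first.
  by move=> [q pq hq]; apply: le_lt_trans hq; exact: min_energy_le.
rewrite -subr_gt0 => gap.
have [_ [u pu <-]] := inf_adherent gap (has_inf_energy (N := N) d_gt0 c0).
rewrite addrC subrK => hu.
pose K := 4 * \sum_(e <- edges d N) c e * (`|gradient u e| + 1).
have K0 : 0 <= K.
  by rewrite mulr_ge0// sumr_ge0// => e _; rewrite mulr_ge0// addr_ge0.
(* [K / m] bounds the energy gained by rounding to multiples of [1 / m]. *)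
pose del := r - energy N c u u.
have del0 : 0 < del by rewrite subr_gt0.
pose m := (Num.trunc (K / del)).+1.
have mK : K / m%:R < del.
  rewrite ltr_pdivrMr ?ltr0n// mulrC -ltr_pdivrMr//.
  exact: truncnS_gt.
have m0 : 0 < m%:R :> R by rewrite ltr0n.
pose phiq (y : R) : rat := (Num.floor (m%:R * y))%:~R / m%:R.
pose phi (y : R) : R := ratr (phiq y).
have phiE y : phi y = (Num.floor (m%:R * y))%:~R / m%:R.
  by rewrite /phi /phiq fmorph_div/= ratr_int ratr_nat.
have phi_nat k : phi k%:R = k%:R.
  have -> : phi k%:R = (Num.floor ((m * k)%N%:Z%:~R : R))%:~R / m%:R.
    by rewrite phiE -pmulrn natrM.
  by rewrite intrKfloor -pmulrn natrM mulrC mulKf// gt_eqF.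
have phi_le y : phi y <= y.
  by rewrite phiE ler_pdivrMr// [y * _]mulrC floor_le.
have phi_gt y : y < phi y + m%:R^-1.
  rewrite phiE -[X in _ + X]mul1r -mulrDl ltr_pdivlMr// [y * _]mulrC.
  by have := floorD1_gt (m%:R * y); rewrite intrD.
pose q : grid := [ffun g : {ffun 'I_d -> 'I_N.+2} =>
    phiq (u (\row_i (g i : nat)%:Z))].
have qE x : cbox d N x -> (phi \o u) x = grid_fun q x.
  move=> hx; rewrite /grid_fun /q ffunE /= /phi; congr (ratr (phiq (u _))).
  by apply/rowP => i; rewrite mxE ffunE inordK; have := hx i; lia.
exists q.
  apply: (potentials_ext qE); apply: potentials_comp => //.
    exact: (phi_nat 0%N).
  by rewrite natr1 phi_nat.
rewrite -(energy_ext c qE); apply: (@le_lt_trans _ _ (energy N c u u + K / m%:R)).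
  rewrite !energy_gradient /K mulrAC mulr_sumr -big_split /=; apply: ler_sum => e _.
  set g := gradient u e; set g' := gradient _ e.
  have -> : c e * g ^+ 2 + 4 / m%:R * (c e * (`|g| + 1)) =
    c e * (g ^+ 2 + 4 / m%:R * (`|g| + 1)) by ring.
  rewrite ler_wpM2l//.
  have m1 : m%:R^-1 <= 1 :> R by rewrite invf_le1// ler1n.
  have mi0 : 0 < m%:R^-1 :> R by rewrite invr_gt0.
  have hg : `|g'| <= `|g| + m%:R^-1.
    have h1 := phi_le (u (src e)); have h2 := phi_gt (u (src e)).
    have h3 := phi_le (u (tgt e)); have h4 := phi_gt (u (tgt e)).
    have h5 := ler_norm g; have h6 : - g <= `|g| by rewrite -normrN ler_norm.
    move: h5 h6; move: (`|g|) => ng; rewrite /g' /g /gradient/= => h5 h6.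
    by rewrite ler_norml; apply/andP; split; lra.
  rewrite -(real_normK (num_real g')) -(real_normK (num_real g)).
  apply: (@le_trans _ _ ((`|g| + m%:R^-1) ^+ 2)).
    by rewrite lerXn2r ?nnegrE ?addr_ge0// ltW.
  have ng := normr_ge0 g.
  have : m%:R^-1 * m%:R^-1 <= m%:R^-1 :> R by rewrite ler_piMl// ltW.
  move: (m%:R^-1) m1 mi0 => t t1 t0 tt.
  have := mulr_ge0 (ltW t0) ng; nra.
by rewrite /del in mK; lra.
Qed.

End measurability.

(** * The effective conductance of a random configuration *)

Section random_conductances.
Context {R : realType}.
Variables (d N : nat) (kappa : R).
Hypotheses (d_gt0 : (0 < d)%N) (N_gt0 : (0 < N)%N) (kappa_gt0 : 0 < kappa).

(** The configuration space contains conductances outside of (0, kappa].  They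
    are sent to [kappa] so that clipping commutes with raising an edge to
    [kappa]. *)
Definition clip (y : R) : R := if 0 < y <= kappa then y else kappa.

Lemma clip_bound y : 0 < clip y <= kappa.
Proof. by rewrite /clip; case: ifP => // _; rewrite kappa_gt0 lexx. Qed.

Lemma clip_id y : 0 < y <= kappa -> clip y = y.
Proof. by rewrite /clip => ->. Qed.

Lemma clip_update (x : edge d -> R) e :
  clip \o update x e kappa = update (clip \o x) e kappa.
Proof.
apply/funext => f; rewrite /update /=; case: ifP => // _.
by rewrite clip_id// kappa_gt0 lexx.
Qed.

Lemma measurable_clip : measurable_fun setT clip.
Proof.
have -> : clip = (fun y => kappa + (y - kappa) * \1_`]0, kappa] y).
  apply/funext => y; rewrite /clip indicE.
  have -> : (y \in `]0, kappa]%classic) = (0 < y <= kappa).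
    by apply/idP/idP; rewrite inE /= in_itv.
  by case: (0 < y <= kappa) => /=; ring.
apply: measurable_funD => //; apply: measurable_funM; last exact: measurable_indic.
exact: measurable_funB.
Qed.

Definition conductance (x : config (edge d) R) : R := eff_cond N (clip \o x).

Definition weak_edges (s : R) (x : config (edge d) R) : R :=
  \sum_(e <- edges d N) ((s <= (clip (x e))^-1)%R)%:R.

Let p : R := N%:R.
Let p_gt0 : 0 < p. Proof. by rewrite ltr0n. Qed.
Let p_ge1 : 1 <= p. Proof. by rewrite ler1n. Qed.

Lemma powR_split (a b : R) : p `^ (a + b) = p `^ a * p `^ b.
Proof. by rewrite powRD// (gt_eqF p_gt0) implybT. Qed.

Lemma sqrN1_le : (p + 1) ^+ 2 <= 4 * p ^+ 2.
Proof. have := p_ge1; nra. Qed.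

Lemma size_edges_le : (size (edges d N))%:R <= 2 * d%:R * p `^ d%:R.
Proof.
rewrite powR_mulrn; last exact: ltW.
by rewrite -natrX -!natrM ler_nat; exact: size_edges.
Qed.

Lemma bmeas_clip_coord (e : edge d) :
  bmeas (fun x : config (edge d) R => clip (x e)).
Proof.
split; first exact: (measurableT_comp measurable_clip (@measurable_coord _ _ e)).
by exists kappa => x; have /andP[h0 h1] := clip_bound (x e); rewrite ger0_norm// ltW.
Qed.

Let clip_ge0 (x : config (edge d) R) e : 0 <= (clip \o x) e.
Proof. by have /andP[/ltW] := clip_bound (x e). Qed.

(** The event that the minimal energy is below [r] is a countable union over
    rational potentials; [unpickle] enumerates them. *)
Lemma bmeas_conductance : bmeas conductance.
Proof.
apply: bmeasZ; split; last first.
  exists (kappa * (size (edges d N))%:R) => x; rewrite ger0_norm.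
    apply: min_energy_le_size => // e.
    by have /andP[/ltW -> ->] := clip_bound (x e).
  exact: min_energy_ge0.
apply: (measurability _ (RGenInftyO.measurableE R)) => //.
move=> _ [_ [r ->] <-]; rewrite setTI.
pose A (q : @grid d N) : set (config (edge d) R) := [set x : config (edge d) R |
  potentials R d N (grid_fun q) /\
  energy N (clip \o x) (grid_fun q) (grid_fun q) < r].
have mA q : measurable (A q).
  have [pq|npq] := pselect (potentials R d N (@grid_fun R d N q)); last first.
    by rewrite [A q](_ : _ = set0)//; apply/seteqP; split => x // [].
  have [me _] : bmeas (fun x : config (edge d) R =>
      energy N (clip \o x) (grid_fun q) (grid_fun q)).
    under [X in bmeas X]funext do rewrite energy_gradient.
    by apply: bmeas_sum => e; apply: bmeasM (bmeas_clip_coord e) (bmeas_cst _).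
  have := me measurableT `]-oo, r[%classic (measurable_itv _).
  rewrite setTI; congr measurable; apply/seteqP; split => x /=; rewrite /A /= in_itv //=.
  by move=> [].
have -> : (fun x : config (edge d) R => min_energy (N := N) (clip \o x)) @^-1` `]-oo, r[ =
    \bigcup_n oapp A set0 (@unpickle (@grid d N) n).
  apply/seteqP; split => x /=; rewrite in_itv/=.
    move=> /(grid_approx d_gt0 r (clip_ge0 x))[q pq hq].
    by exists (pickle q) => //; rewrite pickleK.
  move=> [n _]; case: unpickle => //= q [pq hq].
  by apply/(grid_approx d_gt0 r (clip_ge0 x)); exists q.
by apply: bigcup_measurable => n _; case: unpickle => //= q; exact: mA.
Qed.

Lemma conductance_depends_on : depends_on (edges d N) conductance.
Proof.
move=> x x' xx'; rewrite /conductance !eff_condE; congr (_ * inf _).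
by apply/seteqP; split => _ [u pu <-]; exists u => //;
  rewrite !energy_gradient !big_seq; apply: eq_bigr => e he /=; rewrite xx'.
Qed.

Lemma inv_volumeE : (N%:R ^+ d)^-1 = p `^ (- d%:R).
Proof. by rewrite powR_invn// ltW. Qed.

Lemma conductance_increment_ge0 x e :
  0 <= conductance (update x e kappa) - conductance x.
Proof.
rewrite /conductance !eff_condE -mulrBr mulr_ge0 ?invr_ge0//.
rewrite clip_update subr_ge0; apply: min_energy_update_ge => // f.
exact: clip_bound.
Qed.

Definition increment_bound : R := 4 * kappa * p `^ (2 - d%:R).

Lemma conductance_increment_le x e : e \in edges d N ->
  conductance (update x e kappa) - conductance x <= increment_bound.
Proof.
move=> he; rewrite /conductance !eff_condE -mulrBr inv_volumeE.
have h := min_energy_increment_le d_gt0 (fun f => clip_bound (x f)) he.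
have -> : increment_bound = p `^ (- d%:R) * (kappa * (4 * p ^+ 2)).
  rewrite /increment_bound powR_split (powR_mulrn 2); last exact: ltW.
  by ring.
rewrite clip_update ler_wpM2l ?powR_ge0// (le_trans h)// ler_wpM2l ?sqrN1_le//.
exact: ltW.
Qed.

(** Both values lie between the value with [kappa] at [e] and this value minus
    [increment_bound]. *)
Lemma conductance_oscillation e x y z : e \in edges d N ->
  `|conductance (update x e y) - conductance (update x e z)| <= increment_bound.
Proof.
move=> he.
have h1 := conductance_increment_le (update x e y) he.
have h2 := conductance_increment_le (update x e z) he.
have h3 := conductance_increment_ge0 (update x e y) e.
have h4 := conductance_increment_ge0 (update x e z) e.
rewrite !update_update in h1 h2 h3 h4.
by rewrite ler_norml; apply/andP; split; lra.
Qed.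

Lemma sum_sqr_increment_le s x : 0 <= s ->
  \sum_(e <- edges d N) (conductance (update x e kappa) - conductance x) ^+ 2 <=
  8 * d%:R * kappa ^+ 3 * s * p `^ (2 - d%:R) +
  16 * kappa ^+ 2 * p `^ (4 - 2 * d%:R) * weak_edges s x.
Proof.
move=> s0.
have h := sum_sqr_min_energy_increment_le (N := N) d_gt0
  (fun f => clip_bound (x f)) s0.
set Z := weak_edges s x.
have Z0 : 0 <= Z by rewrite sumr_ge0.
have k0 := ltW kappa_gt0.
apply: (@le_trans _ _ (p `^ (- d%:R) ^+ 2 * (kappa ^+ 2 * (4 * p ^+ 2 *
    (s * (kappa * (2 * d%:R * p `^ d%:R)) + 4 * p ^+ 2 * Z))))).
  under eq_bigr do rewrite /conductance !eff_condE -mulrBr inv_volumeE exprMn clip_update.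
  rewrite -mulr_sumr ler_wpM2l ?sqr_ge0// (le_trans h)// ler_wpM2l ?sqr_ge0//.
  apply: ler_pM; rewrite ?sqr_ge0 ?sqrN1_le//.
    by rewrite addr_ge0// !mulr_ge0// ?sqr_ge0// ltW.
  apply: lerD; last by rewrite ler_wpM2r ?sqrN1_le.
  by rewrite ler_wpM2l// ler_wpM2l// size_edges_le.
rewrite le_eqVlt; apply/orP; left; apply/eqP.
have -> : 4 - 2 * d%:R = (- d%:R + - d%:R) + 4%:R :> R by ring.
have -> : 2 - d%:R = (- d%:R + - d%:R + d%:R) + 2%:R :> R by ring.
rewrite (powR_split (- d%:R + - d%:R) 4%:R).
rewrite (powR_split (- d%:R + - d%:R + d%:R) 2%:R).
rewrite (powR_split (- d%:R + - d%:R) d%:R) (powR_split (- d%:R) (- d%:R)).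
rewrite !(powR_mulrn _ (ltW p_gt0)).
by ring.
Qed.

Lemma measurable_weak_edge s e :
  measurable [set x : config (edge d) R | s <= (clip (x e))^-1].
Proof.
have [mc _] := bmeas_clip_coord e.
have : measurable_fun setT (fun x : config (edge d) R => s * clip (x e)).
  exact: measurable_funM.
move=> /(_ measurableT `]-oo, 1]%classic (measurable_itv _)).
rewrite setTI; congr measurable; apply/seteqP; split => x /=; rewrite in_itv/=;
  have /andP[c0 _] := clip_bound (x e); by rewrite -ler_pdivlMr// div1r.
Qed.

Lemma weak_edgesE s x : weak_edges s x = \sum_(e <- edges d N)
  \1_[set x : config (edge d) R | s <= (clip (x e))^-1] x.
Proof.
apply: eq_bigr => e _; rewrite indicE.
suff -> : (x \in [set x : config (edge d) R | s <= (clip (x e))^-1]) =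
    (s <= (clip (x e))^-1) by [].
by apply/idP/idP; rewrite inE.
Qed.

Lemma bmeas_weak_edges s : bmeas (weak_edges s).
Proof.
under [X in bmeas X]funext do rewrite weak_edgesE.
by apply: bmeas_sum => e; apply: bmeas_indic; exact: measurable_weak_edge.
Qed.

Lemma weak_edges_depends_on s : depends_on (edges d N) (weak_edges s).
Proof.
move=> x x' xx'; rewrite /weak_edges !big_seq; apply: eq_bigr => e he.
by rewrite xx'.
Qed.

Lemma weak_edges_oscillation s e x y z : e \in edges d N ->
  `|weak_edges s (update x e y) - weak_edges s (update x e z)| <= 1.
Proof.
move=> he; rewrite /weak_edges (bigD1_seq e)//= ?uniq_edges//.
rewrite [X in _ - X](bigD1_seq e)//= ?uniq_edges//.
rewrite (_ : \sum_(i <- edges d N | i != e) ((s <= (clip (update x e y i))^-1)%R)%:R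
   = \sum_(i <- edges d N | i != e) ((s <= (clip (update x e z i))^-1)%R)%:R :> R); last first.
  by apply: eq_bigr => i /negbTE ie; rewrite /update ie.
rewrite opprD addrACA subrr addr0.
by case: (s <= _); case: (s <= _); rewrite ?subrr ?subr0 ?sub0r ?normrN ?normr1 ?normr0.
Qed.

End random_conductances.

(** * Variance and deviation estimates *)

Section two_sided.
Context {I : eqType} {R : realType}.
Variables (Q : probability (config I R) R) (mu : I -> probability R R).
Hypothesis QE : product_law Q mu.

Lemma measurable_bmeas_ge {d} {T : measurableType d} (f : T -> R) (h : R) :
  bmeas f -> measurable [set x | h <= f x].
Proof.
move=> [mf _]; have := mf measurableT `[h, +oo[%classic (measurable_itv _).
by rewrite setTI; congr measurable; apply/seteqP; split => x /=; rewrite in_itv/= andbT.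
Qed.

Lemma bounded_differences_abs (s : seq I) (g : config I R -> R) (B V h : R) :
  uniq s -> bmeas g -> depends_on s g ->
  (forall e x y z, e \in s -> `|g (update x e y) - g (update x e z)| <= B) ->
  (size s)%:R * B ^+ 2 <= V -> 0 < V -> 0 <= h ->
  (Q [set x | (h <= `|g x - \int[Q]_x g x|)%R] <=
    (2 * expR (- (h ^+ 2 / (8 * V))))%:E)%E.
Proof.
move=> us bg dg hB hV V0 h0; set m := \int[Q]_x g x.
pose g' := (fun x => - g x) : config I R -> R.
have bg' : bmeas g'.
  by have := bmeasZ (-1) bg; under [X in bmeas X -> _]funext do rewrite mulN1r.
have m' : \int[Q]_x g' x = - m.
  by under eq_Rintegral do rewrite /g' -mulN1r; rewrite meanZ// mulN1r.
have bu := bounded_differences QE us bg dg hB hV V0 h0.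
have bl : (Q [set x | (h <= g' x - \int[Q]_x g' x)%R] <=
    (expR (- (h ^+ 2 / (8 * V))))%:E)%E.
  apply: (bounded_differences QE us bg' _ (B := B)) => //.
    by move=> x x' xx'; rewrite /g' (dg _ _ xx').
  by move=> e x y z he; rewrite /g' -opprD normrN; exact: hB.
rewrite m' in bl; rewrite -/m in bu.
pose A1 : set (config I R) := [set x | (h <= g x - m)%R].
pose A2 : set (config I R) := [set x | (h <= g' x - - m)%R].
rewrite -/A1 in bu; rewrite -/A2 in bl.
have mA1 : measurable A1 by apply/measurable_bmeas_ge/bmeasB/bmeas_cst.
have mA2 : measurable A2 by apply/measurable_bmeas_ge/bmeasB/bmeas_cst.
apply: (@le_trans _ _ (Q (A1 `|` A2))).
  apply: le_measure; rewrite ?inE.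
  - apply: measurable_bmeas_ge.
    have [mf [M hM]] := bmeasB bg (bmeas_cst m); split.
      exact: measurableT_comp.
    by exists M => x; rewrite normr_id.
  - exact: measurableU.
  - move=> x /=; rewrite /A1 /A2 /g' /=.
    by case: (ger0P (g x - m)) => _ hx; [left|right; lra].
apply: le_trans (measureU2 _ mA1 mA2) _.
by rewrite mulr_natl mulr2n EFinD leeD.
Qed.

End two_sided.

Section estimates.
Context {R : realType}.
Variables (d N : nat) (kappa : R).
Hypotheses (d_gt0 : (0 < d)%N) (N_gt0 : (0 < N)%N) (kappa_ge1 : 1 <= kappa).
Variables (Q : probability (config (edge d) R) R) (mu : edge d -> probability R R).
Hypothesis QE : product_law Q mu.

Let kappa_gt0 : 0 < kappa. Proof. exact: lt_le_trans ltr01 kappa_ge1. Qed.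
Let p : R := N%:R.
Let p_gt0 : 0 < p. Proof. by rewrite ltr0n. Qed.
Let p_ge1 : 1 <= p. Proof. by rewrite ler1n. Qed.
Let d_ge1 : 1 <= d%:R :> R. Proof. by rewrite ler1n. Qed.
Let g := @conductance R d N kappa.
Let m := \int[Q]_x g x.
Let powRS := powR_split (R := R) N_gt0.

Let bg : bmeas g. Proof. exact: bmeas_conductance. Qed.

Lemma size_increment_bound : (size (edges d N))%:R *
  increment_bound d N kappa ^+ 2 <= 32 * d%:R * kappa ^+ 2 * p `^ (4 - d%:R).
Proof.
apply: (@le_trans _ _ (2 * d%:R * p `^ d%:R * increment_bound d N kappa ^+ 2)).
  by rewrite ler_wpM2r ?sqr_ge0// size_edges_le.
have -> : 4 - d%:R = d%:R + ((2 - d%:R) + (2 - d%:R)) :> R by ring.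
rewrite (powRS d%:R) (powRS (2 - d%:R)) /increment_bound -/p.
by rewrite le_eqVlt; apply/orP; left; apply/eqP; ring.
Qed.

Lemma variance_bounded_increments :
  \int[Q]_x (g x - m) ^+ 2 <= 32 * d%:R * kappa ^+ 2 * p `^ (4 - d%:R).
Proof.
apply: le_trans (efron_stein QE kappa (uniq_edges d N) bg _) _.
  exact: conductance_depends_on.
apply: le_trans size_increment_bound.
rewrite mulr_natl -iter_addr_0 -(count_predT (edges d N)) -big_const_seq.
rewrite !big_seq; apply: ler_sum => e he.
rewrite -[leRHS](mean_cst Q); apply: mean_le.
- exact/bmeas_sqr/bmeasB/bg/bmeas_update.
- exact: bmeas_cst.
- move=> x.
  have h0 := conductance_increment_ge0 N d_gt0 kappa_gt0 x e.
  have h1 := conductance_increment_le d_gt0 N_gt0 kappa_gt0 x he.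
  by rewrite lerXn2r ?nnegrE// (le_trans h0).
Qed.

(** The bounded difference inequality gives the Gaussian tail
    [2 exp (- y^2 / 2)] with [y = t / (8 kappa sqrt (2 d))]; it is below the
    exponential one since [y - y^2 / 2 <= 1 / 2] and [exp (1 / 2) <= 2]. *)
Lemma tail_bounded_increments (t : R) : 0 < t ->
  (Q [set x | (t * p `^ ((4 - d%:R) / 2) <= `|g x - m|)%R] <=
    (4 * expR (- (t / (8 * kappa * Num.sqrt (2 * d%:R)))))%:E)%E.
Proof.
move=> t0; set h := t * _; set V := 32 * d%:R * kappa ^+ 2 * p `^ (4 - d%:R).
have q0 : 0 < p `^ (4 - d%:R) by exact: powR_gt0.
have V0 : 0 < V by rewrite !mulr_gt0// ?exprn_gt0// (lt_le_trans ltr01).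
have h0 : 0 <= h by rewrite mulr_ge0// ?powR_ge0// ltW.
apply: le_trans (bounded_differences_abs QE (uniq_edges d N) bg
  (@conductance_depends_on R d N kappa)
  (fun e x y z => conductance_oscillation d_gt0 N_gt0 kappa_gt0 x y z)
  size_increment_bound V0 h0) _.
rewrite lee_fin -/V.
have sd0 : 0 < Num.sqrt (2 * d%:R) :> R by rewrite sqrtr_gt0 mulr_gt0// (lt_le_trans ltr01).
set y := t / _.
have h2 : h ^+ 2 = t ^+ 2 * p `^ (4 - d%:R).
  rewrite /h exprMn; congr (_ * _); rewrite expr2 -powRS.
  by congr (_ `^ _); field.
have -> : h ^+ 2 / (8 * V) = y ^+ 2 / 2.
  rewrite h2 /V /y expr_div_n !exprMn sqr_sqrtr; last first.
    by rewrite mulr_ge0// (le_trans ler01).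
  by field; rewrite !gt_eqF//; exact: lt_le_trans ltr01 d_ge1.
have e2 : expR (2^-1) <= 2 :> R.
  have := @expR_le_quadratic R 2^-1; rewrite ger0_norm; last by rewrite invr_ge0.
  by move=> /(_ _)/le_trans; apply; lra.
have : expR (- (y ^+ 2 / 2)) <= expR (2^-1) * expR (- y).
  by rewrite -expRD ler_expR; have := sqr_ge0 (y - 1); lra.
have := expR_gt0 (- y); nra.
Qed.

Variables (D0 gamma : R).
Hypothesis gamma_gt0 : 0 < gamma.
Hypothesis weak_law : forall (e : edge d) (s : R), 1 <= s ->
  (Q [set x | (s <= (clip kappa (x e))^-1)%R] <= (D0 * s `^ (1 - 2 / gamma))%:E)%E.

Lemma D0_ge0 : 0 <= D0.
Proof.
have := weak_law ((0 : site d), Ordinal d_gt0) (lexx 1).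
rewrite powR1 mulr1 => h; rewrite -lee_fin; apply: le_trans h.
exact: measure_ge0.
Qed.

Let s := p `^ gamma.
Let s_ge1 : 1 <= s.
Proof. by rewrite -(powRr0 p) ler_powR// ltW. Qed.
Let Z := @weak_edges R d N kappa s.
Let W := p `^ (2 - d%:R + gamma).
Let bZ : bmeas Z. Proof. exact: bmeas_weak_edges. Qed.

Lemma mean_weak_edges_le :
  \int[Q]_x Z x <= 2 * d%:R * p `^ d%:R * (D0 * p `^ (gamma - 2)).
Proof.
have -> : p `^ (gamma - 2) = s `^ (1 - 2 / gamma).
  by rewrite /s -powRrM; congr (_ `^ _); field; rewrite gt_eqF.
under eq_Rintegral do rewrite /Z weak_edgesE.
rewrite mean_sum; last by move=> e; apply: bmeas_indic; exact: measurable_weak_edge.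
apply: (@le_trans _ _ ((size (edges d N))%:R * (D0 * s `^ (1 - 2 / gamma)))); last first.
  by rewrite ler_wpM2r ?mulr_ge0 ?powR_ge0 ?D0_ge0// size_edges_le.
rewrite mulr_natl -iter_addr_0 -(count_predT (edges d N)) -big_const_seq.
apply: ler_sum => e _; rewrite mean_indic; last exact: measurable_weak_edge.
have := weak_law e s_ge1; rewrite -[X in (X <= _)%E]fineK ?fin_num_measure//.
exact: measurable_weak_edge.
Qed.

Let C0 : R := 32 * d%:R * kappa ^+ 3.

(** The choice [s = N^gamma] gives both terms the order [W = N^(2-d+gamma)]. *)
Lemma weak_mean_contribution :
  8 * d%:R * kappa ^+ 3 * s * p `^ (2 - d%:R) +
  16 * kappa ^+ 2 * p `^ (4 - 2 * d%:R) * \int[Q]_x Z x <= C0 * (D0 + 1) * W.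
Proof.
have k2 : 0 <= 16 * kappa ^+ 2 * p `^ (4 - 2 * d%:R).
  by rewrite !mulr_ge0 ?powR_ge0// ltW.
have := ler_wpM2l k2 mean_weak_edges_le.
have -> : 16 * kappa ^+ 2 * p `^ (4 - 2 * d%:R) *
    (2 * d%:R * p `^ d%:R * (D0 * p `^ (gamma - 2))) = 32 * d%:R * kappa ^+ 2 * D0 * W.
  have -> : W = p `^ (4 - 2 * d%:R) * p `^ d%:R * p `^ (gamma - 2).
    by rewrite -!powRS /W; congr (_ `^ _); ring.
  by ring.
have -> : 8 * d%:R * kappa ^+ 3 * s * p `^ (2 - d%:R) = 8 * d%:R * kappa ^+ 3 * W.
  have -> : W = p `^ (2 - d%:R) * s by rewrite /W powRS.
  by ring.
have W0 : 0 <= W by exact: powR_ge0.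
have D00 := D0_ge0.
have k3 : kappa ^+ 2 <= kappa ^+ 3 by rewrite ler_weXn2l.
have k30 : 0 <= kappa ^+ 3 by rewrite exprn_ge0// ltW.
have h1 : 32 * d%:R * kappa ^+ 2 * D0 * W <= 32 * d%:R * kappa ^+ 3 * D0 * W.
  by rewrite ler_wpM2r// ler_wpM2r// ler_wpM2l.
have h2 : 0 <= d%:R * kappa ^+ 3 * W by rewrite mulr_ge0// mulr_ge0.
rewrite /C0; lra.
Qed.

Lemma variance_weak_law : \int[Q]_x (g x - m) ^+ 2 <= C0 * (D0 + 1) * W.
Proof.
apply: le_trans (efron_stein QE kappa (uniq_edges d N) bg _) _.
  exact: conductance_depends_on.
have bi e : bmeas (fun x : config (edge d) R => (g (update x e kappa) - g x) ^+ 2).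
  exact/bmeas_sqr/bmeasB/bg/bmeas_update.
rewrite -mean_sum//; apply: le_trans weak_mean_contribution.
rewrite -meanZ// -[X in X + _](mean_cst Q) -meanD; [|exact: bmeas_cst|exact: bmeasZ].
apply: mean_le; first exact: bmeas_sum.
  by apply: bmeasD; [exact: bmeas_cst|exact: bmeasZ].
by move=> x; apply: sum_sqr_increment_le => //; exact: le_trans ler01 s_ge1.
Qed.

Let A2 := p `^ (3 * d%:R - 8) / (16 * C0 ^+ 2).

(** The threshold [2 C0 (D0 + 1) W] is twice the bound on the mean, so at least
    [r / 2] must come from the deviation of the number of weak edges, which has
    bounded differences equal to 1. *)
Lemma sum_sqr_increment_tail (r : R) : 2 * C0 * (D0 + 1) * W <= r ->
  (Q [set x | (r < \sum_(e <- edges d N) (g (update x e kappa) - g x) ^+ 2)%R] <=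
    (1 * expR (- (A2 * r ^+ 2)))%:E)%E.
Proof.
move=> hr; rewrite mul1r.
set q := p `^ (4 - 2 * d%:R).
have q0 : 0 < q by exact: powR_gt0.
have pd0 : 0 < p `^ d%:R by exact: powR_gt0.
have d0 : 0 < d%:R :> R by exact: lt_le_trans ltr01 d_ge1.
have C00 : 0 < C0 by rewrite !mulr_gt0// exprn_gt0.
have W0 : 0 < W by exact: powR_gt0.
have r0 : 0 <= r.
  have D10 : 0 < D0 + 1 by rewrite ltr_wpDl ?D0_ge0.
  by apply: le_trans hr; apply: ltW; rewrite !mulr_gt0.
pose V := 2 * d%:R * p `^ d%:R.
have V0 : 0 < V by rewrite !mulr_gt0.
have k2q : 0 < 16 * kappa ^+ 2 * q by rewrite !mulr_gt0// exprn_gt0.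
pose h := r / 2 / (16 * kappa ^+ 2 * q).
have h0 : 0 <= h by rewrite /h !divr_ge0// ltW.
have hV : (size (edges d N))%:R * 1 ^+ 2 <= V.
  by rewrite expr1n mulr1 size_edges_le.
have bd := bounded_differences QE (uniq_edges d N) bZ
  (@weak_edges_depends_on R d N kappa s)
  (fun e x y z => weak_edges_oscillation kappa s x y z) hV V0 h0.
apply: (@le_trans _ _ (Q [set x | (h <= Z x - \int[Q]_x Z x)%R])).
  apply: le_measure; rewrite ?inE.
  - have bs : bmeas (fun x : config (edge d) R =>
        \sum_(e <- edges d N) (g (update x e kappa) - g x) ^+ 2).
      by apply: bmeas_sum => e; exact/bmeas_sqr/bmeasB/bg/bmeas_update.
    have [ms _] := bs; have := ms measurableT `]r, +oo[%classic (measurable_itv _).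
    by rewrite setTI; congr measurable; apply/seteqP; split => x /=; rewrite in_itv/= andbT.
  - by apply/measurable_bmeas_ge/bmeasB/bmeas_cst.
  - move=> x /= hx; rewrite /h ler_pdivrMr//.
    have := sum_sqr_increment_le d_gt0 N_gt0 kappa_gt0 x (le_trans ler01 s_ge1).
    have := weak_mean_contribution; rewrite -/p -/q -/g -/Z.
    lra.
apply: le_trans bd _; rewrite lee_fin ler_expR lerN2 -/V.
have -> : h ^+ 2 / (8 * V) = d%:R * kappa ^+ 2 * (A2 * r ^+ 2).
  rewrite /A2; have -> : p `^ (3 * d%:R - 8) = (q ^+ 2 * p `^ d%:R)^-1.
    by rewrite expr2 /q -!powRS -powRN; congr (_ `^ _); ring.
  by rewrite /h /V /C0; field; rewrite !gt_eqF.
rewrite ler_peMl//; last by rewrite mulr_ege1// exprn_ege1.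
rewrite mulr_ge0 ?sqr_ge0// /A2 divr_ge0 ?powR_ge0//.
by apply: mulr_ge0 => //; exact: sqr_ge0.
Qed.

Lemma expR2_le12 : expR 2 <= 12 :> R.
Proof.
have h : expR (4^-1) <= 4 / 3 :> R.
  rewrite -[leLHS]invrK -expRN -[leRHS]invrK lef_pV2 ?posrE ?invr_gt0 ?expR_gt0//.
  by have := @expR_ge1Dx R (- 4^-1); lra.
have -> : 2 = 8%:R * 4^-1 :> R by lra.
rewrite expRM_natl.
apply: (@le_trans _ _ ((4 / 3) ^+ 8)); first by rewrite lerXn2r// ?nnegrE ?expR_ge0.
lra.
Qed.

(** With [s0 = 2 C0 (D0 + 1) W], the restriction on [t] is exactly
    [t < sqrt s0 ^ 5 * A2].  It makes the cube root in the denominator of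
    Kesten's bound smaller than [sqrt s0], which leaves the exponent
    [c2 t / (2 sqrt s0)].  The condition on [d] and [gamma] bounds the prefactor
    through [s0^2 A2 >= 1 / 9]. *)
Lemma tail_weak_law (c1 c2 t : R) : kesten_constants c1 c2 -> (3 <= d)%N ->
  4 - 2 * gamma <= d%:R -> 0 < t ->
  t < Num.sqrt (C0 * (D0 + 1) ^+ 5 / 8) * p `^ ((d%:R - 6 + 5 * gamma) / 2) ->
  (Q [set x | (t < `|g x - m|)%R] <=
   (11 * c1 * expR (- (c2 / (2 * Num.sqrt (2 * C0 * (D0 + 1))) *
                       p `^ ((d%:R - 2 - gamma) / 2) * t)))%:E)%E.
Proof.
move=> kc d3n dgamma t0 ht.
have d0 : 0 < d%:R :> R by exact: lt_le_trans ltr01 d_ge1.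
have C00 : 0 < C0 by rewrite !mulr_gt0// exprn_gt0.
have W0 : 0 < W by exact: powR_gt0.
have D00 := D0_ge0.
have D10 : 0 < D0 + 1 by rewrite ltr_wpDl.
pose s0 := 2 * C0 * (D0 + 1) * W.
have s00 : 0 < s0 by rewrite !mulr_gt0.
have A20 : 0 < A2 by rewrite divr_gt0 ?powR_gt0// mulr_gt0// exprn_gt0.
have B10 : 0 <= increment_bound d N kappa.
  by rewrite /increment_bound !mulr_ge0 ?powR_ge0// ltW.
have hs0 : expR 2 * increment_bound d N kappa ^+ 2 <= s0.
  apply: (@le_trans _ _ (12 * increment_bound d N kappa ^+ 2)).
    by rewrite ler_wpM2r ?sqr_ge0// expR2_le12.
  rewrite /increment_bound /s0 -/p.
  have hp : p `^ (2 - d%:R) ^+ 2 <= W.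
    rewrite expr2 -powRS /W ler_powR// lerD2l.
    have : 2 <= d%:R :> R by rewrite ler_nat ltnW.
    lra.
  have k2 : 1 <= kappa ^+ 2 by rewrite exprn_ege1.
  have -> : 12 * (4 * kappa * p `^ (2 - d%:R)) ^+ 2 =
    192 * kappa ^+ 2 * p `^ (2 - d%:R) ^+ 2 by ring.
  apply: (@le_trans _ _ (192 * kappa ^+ 2 * W)).
    by rewrite ler_wpM2l// mulr_ge0// sqr_ge0.
  have -> : 2 * C0 * (D0 + 1) * W = 64 * kappa ^+ 2 * (d%:R * kappa * (D0 + 1)) * W.
    by rewrite /C0; ring.
  have d3 : 3 <= d%:R :> R by rewrite ler_nat.
  rewrite ler_wpM2r ?(ltW W0)//.
  have h3 : 3 <= d%:R * kappa * (D0 + 1).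
    rewrite -[leLHS]mulr1; apply: ler_pM => //; last by rewrite lerDr.
    by rewrite -[leLHS]mulr1; apply: ler_pM.
  have := ler_wpM2l (sqr_ge0 kappa) h3; lra.
have main := kesten_bounded_differences QE ((0 : site d), Ordinal d_gt0) kc
  (uniq_edges d N) bg (@conductance_depends_on R d N kappa)
  (fun e x y z => conductance_oscillation d_gt0 N_gt0 kappa_gt0 x y z)
  ltr01 A20 s00 hs0 B10 sum_sqr_increment_tail t0.
apply: le_trans main _; rewrite lee_fin.
have [c10 c20] : 0 < c1 /\ 0 < c2 by case: kc.
pose sg := Num.sqrt s0.
have sg0 : 0 < sg by rewrite sqrtr_gt0.
have sgE : s0 = sg ^+ 2 by rewrite sqr_sqrtr// ltW.
have sgW : sg = Num.sqrt (2 * C0 * (D0 + 1)) * p `^ ((2 - d%:R + gamma) / 2).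
  rewrite /sg /s0 sqrtrM; last by rewrite !mulr_ge0// ltW.
  by congr (_ * _); rewrite -powR12_sqrt ?(ltW W0)// /W -powRrM.
(* The deviation of the sum of squares enters with [C1 = 1]. *)
have prefactor : 1 + 1 + 1 / (s0 ^+ 2 * A2) <= 11.
  have h : 9^-1 <= s0 ^+ 2 * A2.
    have -> : s0 ^+ 2 * A2 = (D0 + 1) ^+ 2 / 4 * p `^ (d%:R - 4 + 2 * gamma).
      have -> : p `^ (d%:R - 4 + 2 * gamma) = W ^+ 2 * p `^ (3 * d%:R - 8).
        by rewrite expr2 /W -!powRS; congr (_ `^ _); ring.
      by rewrite /s0 /A2; field; rewrite gt_eqF.
    have h1 : 1 <= p `^ (d%:R - 4 + 2 * gamma).
      by rewrite -[leLHS](powRr0 p) ler_powR//; lra.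
    have h2 : 1 <= (D0 + 1) ^+ 2 by rewrite exprn_ege1// lerDr.
    apply: (@le_trans _ _ (4^-1 * 1)); first by lra.
    by apply: ler_pM => //; lra.
  have : 1 / (s0 ^+ 2 * A2) <= 9.
    rewrite div1r -[leRHS]invrK lef_pV2 ?posrE ?invr_gt0//.
    by rewrite mulr_gt0// exprn_gt0.
  lra.
have cube : t / (s0 * A2) <= sg ^+ 3.
  rewrite ler_pdivrMr; last by rewrite mulr_gt0.
  apply/ltW/(lt_le_trans ht).
  rewrite le_eqVlt; apply/orP; left; apply/eqP.
  have -> : sg ^+ 3 * (s0 * A2) = sg ^+ 5 * A2 by rewrite sgE; ring.
  rewrite sgW exprMn; set rt := Num.sqrt (2 * C0 * (D0 + 1)).
  have rt2 : rt ^+ 2 = 2 * C0 * (D0 + 1) by rewrite sqr_sqrtr// !mulr_ge0// ltW.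
  have -> : Num.sqrt (C0 * (D0 + 1) ^+ 5 / 8) = (D0 + 1) ^+ 2 / 4 * rt.
    have -> : C0 * (D0 + 1) ^+ 5 / 8 = ((D0 + 1) ^+ 2 / 4 * rt) ^+ 2.
      by rewrite exprMn rt2; field.
    by rewrite sqrtr_sqr ger0_norm// mulr_ge0 ?sqrtr_ge0// divr_ge0// sqr_ge0.
  have -> : rt ^+ 5 = rt * (2 * C0 * (D0 + 1)) ^+ 2 by rewrite -rt2; ring.
  have -> : p `^ ((d%:R - 6 + 5 * gamma) / 2) =
      p `^ ((2 - d%:R + gamma) / 2) ^+ 5 * p `^ (3 * d%:R - 8).
    rewrite -powR_mulrn ?powR_ge0// -powRrM -powRS; congr (_ `^ _).
    by field.
  by rewrite /A2; field; rewrite gt_eqF.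
have root : (t / (s0 * A2)) `^ (3^-1) <= sg.
  have -> : sg = (sg ^+ 3) `^ (3^-1).
    by rewrite -powR_mulrn ?(ltW sg0)// -powRrM divff// powRr1// ltW.
  apply: ge0_ler_powR => //; rewrite nnegrE ltW//.
    by rewrite divr_gt0// mulr_gt0.
  by rewrite exprn_gt0.
apply: ler_pM.
- rewrite mulr_ge0 ?(ltW c10)// addr_ge0// divr_ge0// mulr_ge0 ?(ltW A20)//.
  exact: sqr_ge0.
- exact: expR_ge0.
- by rewrite mulrC ler_wpM2r// ltW.
rewrite ler_expR lerN2.
have -> : c2 / (2 * Num.sqrt (2 * C0 * (D0 + 1))) * p `^ ((d%:R - 2 - gamma) / 2) * t =
    c2 * (t / (2 * sg)).
  have -> : p `^ ((d%:R - 2 - gamma) / 2) = (p `^ ((2 - d%:R + gamma) / 2))^-1.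
    by rewrite -powRN; congr (_ `^ _); field.
  rewrite sgW; field.
  by rewrite !gt_eqF// ?powR_gt0// sqrtr_gt0 !mulr_gt0.
rewrite ler_wpM2l ?(ltW c20)// ler_wpM2l ?(ltW t0)//.
rewrite lef_pV2 ?posrE ?mulr_gt0//; first by rewrite -/sg; lra.
by rewrite ltr_wpDr// powR_ge0.
Qed.

End estimates.

(** * The joint law of the conductances and the main theorem *)

Section joint_law.
Context {disp : measure_display} {T : measurableType disp} {R : realType}.
Variables (P : probability T R) (I : eqType) (a : I -> {RV P >-> R}).

Lemma measurable_joint :
  measurable_fun setT (fun w => (fun i => a i w) : config I R).
Proof. by apply: measurable_to_config => i; exact: measurable_funP. Qed.

Definition joint : {mfun T >-> config I R} :=
  HB.pack (fun w => (fun i => a i w) : config I R)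
    (isMeasurableFun.Build _ _ _ _ _ measurable_joint).

Lemma joint_product_law : mutually_independent a ->
  product_law (distribution P joint) (fun i => distribution P (a i)).
Proof.
move=> ind s B us mB; rewrite /distribution /pushforward /= -(ind s B us mB).
congr (P _); apply/funext => w; apply/propext.
elim: s us => [|i s ih] /=; first by rewrite big_nil.
move=> /andP[_ us]; rewrite big_cons; split.
  move=> h; split; first exact: h (mem_head _ _).
  by apply/(ih us) => j js; apply: h; rewrite inE js orbT.
by move=> [hi /(ih us) hs] j; rewrite inE => /orP[/eqP ->//|/hs].
Qed.

Lemma mean_joint (g : config I R -> R) : bmeas g ->
  fine 'E_P[g \o joint] = \int[distribution P joint]_x g x.
Proof.
move=> bg; rewrite unlock /Rintegral integral_distribution//.
  by have [mg _] := bg; exact/measurable_EFinP.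
have [mg [M hM]] := bg.
apply: (bmeas_integrable P (f := g \o joint)); split; last by exists M => w; exact: hM.
exact: measurableT_comp.
Qed.

Lemma variance_joint (g : config I R -> R) : bmeas g ->
  'V_P[g \o joint] = (\int[distribution P joint]_x
    (g x - \int[distribution P joint]_x g x) ^+ 2)%:E.
Proof.
move=> bg; rewrite /variance unlock mean_joint// unlock.
set m := \int[_]_x g x.
have bs : bmeas (fun x => (g x - m) ^+ 2) by exact/bmeas_sqr/bmeasB/bmeas_cst.
rewrite EFin_Rintegral// ge0_integral_distribution//.
  by have [mg _] := bs; exact/measurable_EFinP.
by move=> y; rewrite lee_fin sqr_ge0.
Qed.

End joint_law.

Unset Implicit Arguments.
Set Strict Implicit.
Set Printing Implicit Defensive.

Theorem theorem3 (R : realType) (disp : measure_display)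
    (T : measurableType disp) (P : probability T R)
    (d : nat) (kappa : R) (a : edge d -> {RV P >-> R})
    (kappa_ge1 : 1 <= kappa)
    (a_indep : mutually_independent a)
    (a_ident : identically_distributed a)
    (a_bound : forall e w, 0 < a e w <= kappa) :
  let C0 : R := 32 * d%:R * kappa ^+ 3 in
  let f (N : nat) : T -> R := fun w => eff_cond N (fun e => a e w) in
  let tail (D0 gamma : R) : Prop := forall (e : edge d) (s : R), 1 <= s ->
    (P [set w | (s <= (a e w)^-1)%R] <= (D0 * s `^ (1 - 2 / gamma))%:E)%E in
  [/\
    (5 <= d)%N ->
      (forall N : nat, (1 <= N)%N ->
        ('V_P[f N] <= (128 * d%:R * kappa ^+ 2 * N%:R `^ (4 - d%:R))%:E)%E) /\
      (forall (t : R) (N : nat), 0 < t -> (1 <= N)%N ->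
        (P [set w | (t * N%:R `^ ((4 - d%:R) / 2) <=
                     `|f N w - fine 'E_P[f N]|)%R] <=
         (4 * expR (- (t / (8 * kappa * Num.sqrt (2 * d%:R)))))%:E)%E),
    forall D0 gamma : R, 0 < gamma < 2 -> tail D0 gamma ->
      (4 <= d)%N \/ (d = 3%N /\ 2^-1 <= gamma < 1) ->
      forall N : nat, (1 <= N)%N ->
        ('V_P[f N] <= (16 * C0 * (D0 + 1) * N%:R `^ (2 - d%:R + gamma))%:E)%E /\
        (forall c1 c2 : R, kesten_constants c1 c2 ->
          forall t : R, 0 < t ->
          t < Num.sqrt (C0 * (D0 + 1) ^+ 5 / 8) *
              N%:R `^ ((d%:R - 6 + 5 * gamma) / 2) ->
          (P [set w | (t < `|f N w - fine 'E_P[f N]|)%R] <=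
           (11 * c1 * expR (- (c2 / (2 * Num.sqrt (2 * C0 * (D0 + 1))) *
                               N%:R `^ ((d%:R - 2 - gamma) / 2) * t)))%:E)%E) &
    forall D0 gamma : R, 0 < gamma < 2 -> tail D0 gamma ->
      d = 3%N -> gamma <= 2^-1 ->
      forall N : nat, (1 <= N)%N ->
        ('V_P[f N] <= (16 * C0 * (D0 + 1) * N%:R `^ (- 2^-1))%:E)%E].
Proof.
move=> C0 f tail.
have kappa_gt0 : 0 < kappa := lt_le_trans ltr01 kappa_ge1.
pose Q := distribution P (joint a).
have QE := joint_product_law a_indep.
pose g N := @conductance R d N kappa.
have fE N : f N = g N \o joint a.
  apply/funext => w; rewrite /f /g /conductance /=; congr (eff_cond N _).
  by apply/funext => e; rewrite /= clip_id.
have bg N : (0 < d)%N -> bmeas (g N) by move=> d0; exact: bmeas_conductance.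
have slack D0 (W : R) : 0 <= D0 -> 0 <= W ->
    C0 * (D0 + 1) * W <= 16 * C0 * (D0 + 1) * W.
  move=> D00 W0; have : 0 <= C0 * (D0 + 1) * W.
    by rewrite !mulr_ge0 ?exprn_ge0 ?addr_ge0// ltW.
  lra.
have weak D0 gamma : tail D0 gamma -> forall (e : edge d) (s : R), 1 <= s ->
    (Q [set x | (s <= (clip kappa (x e))^-1)%R] <= (D0 * s `^ (1 - 2 / gamma))%:E)%E.
  move=> h e s s1; apply: le_trans (h e s s1).
  rewrite le_eqVlt; apply/orP; left; apply/eqP; rewrite /Q /distribution /pushforward.
  by congr (P _); apply/seteqP; split => w /=; rewrite clip_id.
split.
- move=> d5; have d0 : (0 < d)%N by exact: leq_trans d5.
  split=> [N N1|t N t0 N1]; rewrite fE.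
    rewrite (variance_joint _ (bg N d0)) lee_fin.
    apply: le_trans (variance_bounded_increments d0 N1 kappa_ge1 QE) _.
    rewrite ler_wpM2r ?powR_ge0// ler_wpM2r ?sqr_ge0// ler_wpM2r//.
    by rewrite ler_nat.
  rewrite (mean_joint _ (bg N d0)).
  exact: (tail_bounded_increments d0 N1 kappa_ge1 QE).
- move=> D0 gamma /andP[gamma0 gamma2] htail hd N N1.
  have d3 : (3 <= d)%N by case: hd => [/ltnW//|[->]].
  have d0 : (0 < d)%N by exact: leq_trans d3.
  rewrite fE; split.
    rewrite (variance_joint _ (bg N d0)) lee_fin.
    apply: le_trans (variance_weak_law d0 N1 kappa_ge1 QE gamma0 (weak _ _ htail)) _.
    by apply: slack; [exact: (D0_ge0 d0 (weak _ _ htail))|exact: powR_ge0].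
  move=> c1 c2 kc t t0 ht; rewrite (mean_joint _ (bg N d0)).
  apply: (tail_weak_law d0 N1 kappa_ge1 QE gamma0 (weak _ _ htail)) => //.
  case: hd => [d4|[-> /andP[g1 _]]]; last by lra.
  have : 4 <= d%:R :> R by rewrite (ler_nat _ 4).
  lra.
- move=> D0 gamma /andP[gamma0 gamma2] htail d3 gammah N N1.
  have d0 : (0 < d)%N by rewrite d3.
  have htail' : tail D0 2^-1.
    move=> e s s1; apply: le_trans (htail e s s1) _; rewrite lee_fin.
    rewrite ler_wpM2l ?(D0_ge0 d0 (weak _ _ htail))// ler_powR// lerD2l lerN2.
    by rewrite ler_wpM2l// lef_pV2 ?posrE ?invr_gt0.
  rewrite fE (variance_joint _ (bg N d0)) lee_fin.
  have h0 : 0 < 2^-1 :> R by rewrite invr_gt0.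
  apply: le_trans (variance_weak_law d0 N1 kappa_ge1 QE h0 (weak _ _ htail')) _.
  have -> : 2 - d%:R + 2^-1 = - 2^-1 :> R by rewrite d3; lra.
  by apply: slack; [exact: (D0_ge0 d0 (weak _ _ htail))|exact: powR_ge0].
Qed.
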